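(* Let $X\subseteq\mathbb{R}^n$ be nonempty, closed and convex, let $Y\subseteq\mathbb{R}^m$ be compact and convex with $\mathrm{vol}(Y)>0$, and let $O_X\supseteq X$ and $O_Y\supseteq Y$ be open sets. Let $g:\mathbb{R}^n\times\mathbb{R}^m\to\mathbb{R}$ be Lipschitz continuous and let $\{g_\mu:\mu>0\}$ be a family of smooth approximations of $g$ over $O_X\times O_Y$. Let $\bar x\in O_X$ and suppose that: (1) for every open set $\Omega'$ with $\mathrm{cl}(\Omega')\subseteq O_X$, $g_\mu\to g$ uniformly on $\mathrm{cl}(\Omega')\times Y$ as $\mu\searrow0$; (2) $\mathrm{dist}(\nabla_xg_\mu(x,\cdot),\partial_xg(x,\cdot))$ converges to $0$ uniformly on $Y$ as $(x,\mu)\to(\bar x,0)$ with $\mu>0$. Define $v(x)=\min_{y\in Y}g(x,y)$, $S(x)=\operatorname{arg\,min}_{y\in Y}g(x,y)$, and $v_\mu^{\rm ent}(x)=-\mu\ln\big(\int_Y\exp(-\mu^{-1}g_\mu(x,y))\,dy\big)$ for $x\in O_X$, $\mu>0$. Then the family of smooth approximations $\{v_\mu^{\rm ent}:\mu>0\}$ of $v$ satisfies the gradient consistent property at $\bar x$ under any one of the following conditions, where $\Omega$ is a neighborhood of $\bar x$: (a) $\nabla_xg(x,y)$ exists and is continuous on $\Omega\times Y$; (b) there is $\rho>0$ such that $g(\cdot,y)$ is $\rho$-weakly concave on $\Omega$ for any $y\in Y$; or (c) $\partial g(\bar x,\bar y)=\partial_xg(\bar x,\bar y)\times\partial_yg(\bar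 x,\bar y)$ for all $\bar y\in S(\bar x)$, and $g$ is convex in $(x,y)$.
   Context: Smooth approximations: for an open set $O\subseteq\mathbb{R}^d$ and a continuous function $\phi:O\to\mathbb{R}$, $\{\phi_\mu:\mu>0\}$ is a family of smooth approximations of $\phi$ over $O$ if each $\phi_\mu:O\to\mathbb{R}$ is continuously differentiable and for all $\bar z\in O$, $\lim_{z\to\bar z,\ \mu\searrow0}\phi_\mu(z)=\phi(\bar z)$. Such a family satisfies the gradient consistent property at $\bar z\in O$ if $\emptyset\neq\limsup_{z\to\bar z,\mu\searrow0}\nabla\phi_\mu(z)\subseteq\partial\phi(\bar z)$, where the limsup is the set of all $\xi\in\mathbb{R}^d$ for which there exist $z^k\to\bar z$ and $\mu_k\searrow0$ (with $\mu_k>0$) such that $\nabla\phi_{\mu_k}(z^k)\to\xi$. $\partial\phi$ is the Clarke generalized gradient: $\partial\phi(\bar z)=\{\xi:\phi^\circ(\bar z;d)\ge\langle\xi,d\rangle\ \forall d\}$ with $\phi^\circ(\bar z;d)=\limsup_{z\to\bar z,\,t\searrow0}\frac{\phi(z+td)-\phi(z)}{t}$. $\partial_xg(x,y)$ and $\partial_yg(x,y)$ are the Clarke generalized gradients of $g(\cdot,y)$ at $x$ and of $g(x,\cdot)$ at $y$. $h$ is $\rho$-weakly concave on a convex set $\Omega$ if $-h+\frac{\rho}{2}\|\cdot\|^2$ is convex on $\Omega$ (so $\Omega$ is understood to be convex in case (b)). $\mathrm{dist}(z,A)=\min\{\|a-z\|:a\in A\}$; $\mathrm{vol}$ is Lebesgue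 measure; $\mathrm{cl}$ is closure. *)

(* Defs.v *)
(* R^d is 'rV[R]_d for an abstract realType R. *)
From HB Require Import structures.
From mathcomp Require Import all_boot all_order all_algebra.
From mathcomp Require Import all_classical all_reals all_analysis.

Set Implicit Arguments.
Unset Strict Implicit.
Unset Printing Implicit Defensive.

Import Order.TTheory GRing.Theory Num.Theory.
Import numFieldNormedType.Exports.

Local Open Scope classical_set_scope.
Local Open Scope ring_scope.

(* The norm that the library puts on 'rV[R]_d is the sup norm, which gives the
   usual topology; inner products and distances below are Euclidean. *)
Definition dotv (R : realType) (d : nat) (u v : 'rV[R]_d) : R :=
  \sum_(i < d) u 0 i * v 0 i.

Definition enorm (R : realType) (d : nat) (u : 'rV[R]_d) : R :=
  Num.sqrt (dotv u u).

(* R^n x R^m is identified with R^(n+m), the point (x, y) being row_mx x y. *)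
Definition rVprod (R : realType) (n m : nat)
    (A : set 'rV[R]_n) (B : set 'rV[R]_m) : set 'rV[R]_(n + m) :=
  [set z | A (lsubmx z) /\ B (rsubmx z)].

(* The infimum is a minimum when A is nonempty and closed; [inf set0 = 0]. *)
Definition dist_set (R : realType) (d : nat) (z : 'rV[R]_d) (A : set 'rV[R]_d) : R :=
  inf [set enorm (a - z) | a in A].

Definition grad (R : realType) (d : nat) (f : 'rV[R]_d -> R) (z : 'rV[R]_d) :
    'rV[R]_d :=
  \row_(i < d) 'D_(delta_mx 0 i) f z.

Definition cont_differentiable (R : realType) (d : nat) (O : set 'rV[R]_d)
    (f : 'rV[R]_d -> R) : Prop :=
  forall z, O z -> differentiable f z /\ {for z, continuous (grad f)}.

Definition clarke_dd (R : realType) (d : nat) (f : 'rV[R]_d -> R)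
    (z u : 'rV[R]_d) : \bar R :=
  limf_esup (fun p : 'rV[R]_d * R => ((f (p.1 + p.2 *: u) - f p.1) / p.2)%:E)
    (filter_prod (nbhs z) 0^'+).

Definition clarke (R : realType) (d : nat) (f : 'rV[R]_d -> R)
    (z : 'rV[R]_d) : set 'rV[R]_d :=
  [set xi | forall u, ((dotv xi u)%:E <= clarke_dd f z u)%E].

(* Functions on O are total functions whose values outside O are irrelevant:
   O being open, every filter below eventually lives in O. *)
Definition smooth_approximations (R : realType) (d : nat) (O : set 'rV[R]_d)
    (phi : 'rV[R]_d -> R) (phi_ : R -> 'rV[R]_d -> R) : Prop :=
  [/\ open O,
      forall z, O z -> {for z, continuous phi},
      forall mu, 0 < mu -> cont_differentiable O (phi_ mu)
    & forall z, O z ->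
        phi_ p.2 p.1 @[p --> filter_prod (nbhs z) 0^'+] --> phi z].

Definition grad_limsup (R : realType) (d : nat)
    (phi_ : R -> 'rV[R]_d -> R) (z : 'rV[R]_d) : set 'rV[R]_d :=
  [set xi | exists (zs : nat -> 'rV[R]_d) (mus : nat -> R),
    [/\ zs @ \oo --> z,
        forall k, 0 < mus k,
        mus @ \oo --> (0 : R)
      & grad (phi_ (mus k)) (zs k) @[k --> \oo] --> xi]].

Definition gradient_consistent (R : realType) (d : nat)
    (phi : 'rV[R]_d -> R) (phi_ : R -> 'rV[R]_d -> R) (z : 'rV[R]_d) : Prop :=
  grad_limsup phi_ z !=set0 /\ grad_limsup phi_ z `<=` clarke phi z.

Definition weakly_concave (R : realType) (d : nat) (rho : R)
    (Omega : set 'rV[R]_d) (h : 'rV[R]_d -> R) : Prop :=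
  convex_set Omega /\
  convex_function Omega (fun x => - h x + rho / 2 * enorm x ^+ 2).

(* The infimum is attained when Y is nonempty and compact and g is continuous. *)
Definition min_value (R : realType) (n m : nat) (Y : set 'rV[R]_m)
    (g : 'rV[R]_(n + m) -> R) (x : 'rV[R]_n) : R :=
  inf [set g (row_mx x y) | y in Y].

Definition argmin_set (R : realType) (n m : nat) (Y : set 'rV[R]_m)
    (g : 'rV[R]_(n + m) -> R) (x : 'rV[R]_n) : set 'rV[R]_m :=
  [set y | Y y /\ forall y', Y y' -> g (row_mx x y) <= g (row_mx x y')].

Section with_sigma_finite.
Context d (T : measurableType d) (R : realType).
Context (la : {measure set T -> \bar R}) (lasf : sigma_finite setT la).

Definition with_sigma_finite (_ : sigma_finite setT la) : set T -> \bar R := la.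

HB.instance Definition _ := Measure.copy (with_sigma_finite lasf) la.
HB.instance Definition _ :=
  Measure_isSigmaFinite.Build _ _ _ (with_sigma_finite lasf) lasf.

End with_sigma_finite.

Section cons_tuple.
Context (R : realType).
Local Notation T := (measurableTypeR R).

Definition consT (m : nat) (p : T * m.-tuple T) : m.+1.-tuple T :=
  [tuple of p.1 :: p.2].

Lemma measurable_consT (m : nat) : measurable_fun setT (@consT m).
Proof. exact: measurable_cons. Qed.

(* m-fold product of the one-dimensional Lebesgue measure, which the library
   only provides on R; the measure on R^0 is the Dirac mass at its point. *)
Fixpoint lebesgue_tuple (m : nat) : set (m.-tuple T) -> \bar R :=
  if m is k.+1
  then pushforward (@lebesgue_measure R \x @lebesgue_tuple k)%E (@consT k)
  else \d_([tuple] : 0.-tuple T).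

Lemma lebesgue_tuple_measureP (m : nat) :
  exists mu : {sigma_finite_measure set (m.-tuple T) -> \bar R},
    lebesgue_tuple (m := m) = mu.
Proof.
elim: m => [|m [mu muE]].
  by exists (dirac ([tuple] : 0.-tuple T)).
rewrite /= muE.
pose nu := pushforward (@lebesgue_measure R \x mu)%E (@consT m).
pose f (t : m.+1.-tuple T) : T * m.-tuple T := (thead t, [tuple of behead t]).
have mf : measurable_fun setT f.
  by apply/measurable_fun_pairP; split;
    [exact: measurable_tnth|exact: measurable_behead].
have consTK : cancel f (@consT m).
  by move=> t; rewrite /f /consT /=; apply/val_inj; rewrite [in RHS](tuple_eta t).
have fK : cancel (@consT m) f.
  by move=> [x t]; rewrite /f; congr pair; apply/val_inj.
have nusf : sigma_finite setT nu.
  have /sigma_finiteP[F [FT ndF Foo]] := sigma_finiteT (@lebesgue_measure R).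
  have /sigma_finiteP[G [GT ndG Goo]] := sigma_finiteT mu.
  exists (fun k => f @^-1` (F k `*` G k)).
    apply/seteqP; split => // t _.
    have [k _ Fk] : (\bigcup_k F k) (f t).1 by rewrite -FT.
    have [l _ Gl] : (\bigcup_k G k) (f t).2 by rewrite -GT.
    exists (maxn k l) => //; split.
    - by move: Fk; exact/subsetPset/ndF/leq_maxl.
    - by move: Gl; exact/subsetPset/ndG/leq_maxr.
  move=> k; have [mF Foo'] := Foo k; have [mG Goo'] := Goo k; split.
    by rewrite -[X in measurable X]setTI; apply: mf => //; exact: measurableX.
  rewrite /nu /pushforward -comp_preimage (_ : f \o _ = id); last exact/funext.
  by rewrite preimage_id product_measure1E// lte_mul_pinfty// ge0_fin_numE.
by exists (with_sigma_finite (la :=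
  measure_function_pushforward__canonical__measure_function_Measure
    (@lebesgue_measure R \x mu)%E (@measurable_consT m)) nusf).
Qed.

Let mu0 m : lebesgue_tuple (m := m) set0 = 0%E.
Proof. by have [mu ->] := lebesgue_tuple_measureP m; exact: measure0. Qed.

Let mu_ge0 m A : (0 <= lebesgue_tuple (m := m) A)%E.
Proof. by have [mu ->] := lebesgue_tuple_measureP m; exact: measure_ge0. Qed.

Let mu_semi_sigma_additive m : semi_sigma_additive (lebesgue_tuple (m := m)).
Proof.
by have [mu ->] := lebesgue_tuple_measureP m; exact: measure_semi_sigma_additive.
Qed.

HB.instance Definition _ (m : nat) := isMeasure.Build _ _ _
  (lebesgue_tuple (m := m)) (@mu0 m) (@mu_ge0 m) (@mu_semi_sigma_additive m).

Let mu_sigma_finite m : sigma_finite setT (lebesgue_tuple (m := m)).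
Proof. by have [mu ->] := lebesgue_tuple_measureP m; exact: sigma_finiteT. Qed.

HB.instance Definition _ (m : nat) := Measure_isSigmaFinite.Build _ _ _
  (lebesgue_tuple (m := m)) (@mu_sigma_finite m).

End cons_tuple.

Definition borel_rV (R : realType) (m : nat) :=
  g_sigma_algebraType (@open 'rV[R]_m).

HB.instance Definition _ (R : realType) (m : nat) :=
  Measurable.on (borel_rV R m).

Section lebesgue_rV.
Context (R : realType) (m : nat).
Local Notation T := (measurableTypeR R).

Definition row_of_tuple (t : m.-tuple T) : borel_rV R m := \row_i tnth t i.

Lemma measurable_row_of_tuple : measurable_fun setT row_of_tuple.
Proof.
apply: measurability => // _ [U oU <-]; rewrite setTI.
pose box (p : 'rV[rat]_m * 'rV[rat]_m) : set 'rV[R]_m :=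
  [set v | forall i, ratr (p.1 0 i) < v 0 i < ratr (p.2 0 i)].
have -> : U = \bigcup_p (if `[< box p `<=` U >] then box p else set0).
  apply/seteqP; split => [v Uv|v [p _]]; last by case: asboolP => // pU /pU.
  have /nbhs_ballP[e /= e0 eU] : nbhs v U by exact: open_nbhs_nbhs.
  have /choice[a av] (i : 'I_m) : exists q, v 0 i - e < ratr q < v 0 i.
    have /rat_in_itvoo[q] : v 0 i - e < v 0 i by rewrite ltrBlDr ltrDl.
    by rewrite in_itv; exists q.
  have /choice[b bv] (i : 'I_m) : exists q, v 0 i < ratr q < v 0 i + e.
    have /rat_in_itvoo[q] : v 0 i < v 0 i + e by rewrite ltrDl.
    by rewrite in_itv; exists q.
  exists (\row_i a i, \row_i b i) => //; case: asboolP => [_ i|[]]/=.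
    by rewrite !mxE; have /andP[_ ->] := av i; have /andP[-> _] := bv i.
  move=> w wab; apply: eU; split=> // k i; rewrite (ord1 k).
  have := wab i; rewrite /= !mxE => /andP[aw wb].
  have /andP[va _] := av i; have /andP[_ vb] := bv i.
  by rewrite /ball/= ltr_distlC (lt_trans va)//= (lt_trans wb).
rewrite preimage_bigcup; apply: countable_bigcupT_measurable => // p.
case: asboolP => _; last by rewrite preimage_set0.
rewrite (_ : _ @^-1` _ = \bigcap_(i in [set: 'I_m])
    (@tnth m T ^~ i) @^-1` [set` `]ratr (p.1 0 i) : R, ratr (p.2 0 i)[]).
  apply: fin_bigcap_measurable => // i _; rewrite -[X in measurable X]setTI.
  by apply: measurable_tnth => //; exact: measurable_itv.
apply/seteqP; split => [t pt i _|t pt i] /=.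
  by have := pt i; rewrite /= mxE in_itv.
by have := pt i Logic.I; rewrite /= mxE in_itv.
Qed.

Definition lebesgue_rV : set (borel_rV R m) -> \bar R :=
  pushforward (lebesgue_tuple (R := R) (m := m)) row_of_tuple.

HB.instance Definition _ := Measure.copy lebesgue_rV
  (measure_function_pushforward__canonical__measure_function_Measure
    (lebesgue_tuple (R := R) (m := m)) measurable_row_of_tuple).

End lebesgue_rV.

Definition gradx (R : realType) (n m : nat) (g : 'rV[R]_(n + m) -> R)
    (x : 'rV[R]_n) (y : 'rV[R]_m) : 'rV[R]_n :=
  grad (fun x' => g (row_mx x' y)) x.

Definition clarkex (R : realType) (n m : nat) (g : 'rV[R]_(n + m) -> R)
    (x : 'rV[R]_n) (y : 'rV[R]_m) : set 'rV[R]_n :=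
  clarke (fun x' => g (row_mx x' y)) x.

Definition clarkey (R : realType) (n m : nat) (g : 'rV[R]_(n + m) -> R)
    (x : 'rV[R]_n) (y : 'rV[R]_m) : set 'rV[R]_m :=
  clarke (fun y' => g (row_mx x y')) y.

Definition entropic (R : realType) (n m : nat) (Y : set 'rV[R]_m)
    (g_ : R -> 'rV[R]_(n + m) -> R) (mu : R) (x : 'rV[R]_n) : R :=
  - mu * ln (\int[lebesgue_rV (R := R) (m := m)]_(y in Y)
               expR (- mu^-1 * g_ mu (row_mx x y))).

(* Main.v *)
(* The gradient of the entropic smoothing at x is the mean of grad_x g_mu(x, .)
   under the Gibbs weight exp(-g_mu(x, .) / mu) on Y.  As Y is convex with
   positive volume, relatively open pieces of Y have positive volume, so this
   weight concentrates on the minimizers of g(xbar, .) (Laplace's principle).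
   Since grad_x g_mu is uniformly close to the partial Clarke gradient, every
   limit xi of gradients satisfies, for each direction u and some minimizer
   ybar depending on u:
     <xi, u> <= limsup (g(x + s u, y) - g(x, y)) / s
   as (x, y, s) tends to (xbar, ybar, 0+).
   Under (a) and (b) the quotient is bounded, up to a vanishing error, by the
   backward quotient (g(xbar, ybar) - g(xbar - t u, ybar)) / t, which is at most
   (v(xbar) - v(xbar - t u)) / t because ybar is a minimizer.  Under (c) the
   bound becomes the partial Clarke derivative of g(., ybar); pairing a
   subgradient attaining it with a subgradient of g(xbar, .) that is nonnegative
   towards a given y in Y yields a subgradient of the convex function g, hence
   a lower bound on v(xbar + t u) - v(xbar). *)
Require Import Defs.
From HB Require Import structures.
From mathcomp Require Import all_boot all_order all_algebra.
From mathcomp Require Import all_classical all_reals all_analysis measurable_realfun.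
From mathcomp Require Import ring lra.

Set Implicit Arguments.
Unset Strict Implicit.
Unset Printing Implicit Defensive.

Import Order.TTheory GRing.Theory Num.Theory.
Import numFieldNormedType.Exports.

Local Open Scope classical_set_scope.
Local Open Scope ring_scope.

(** * Lebesgue measure on R^m *)

(** Membership in [clarke] is tested one direction at a time. The minimizer may therefore depend on
    [u], and a limit of gradients never has to be represented as a mean of subgradients, which
    avoids measurable selections. A minimizer [ybar] of [g(xbar, .)] yields [v(x) <= g(x, ybar)]
    with equality at [xbar], so it controls [v] away from [xbar] only from above. Such a bound
    minorizes a difference quotient of [v] only when the value away from [xbar] is the subtracted
    one. This is why backward quotients appear under (a) and (b), and the moving base point of the
    Clarke derivative is what admits them. Under (c) the increment is forward, so [g(xbar + t u, y)]
    must be bounded below for every [y] in [Y], and a subgradient in [x] alone cannot do that. The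
    set of limit gradients is nonempty by compactness: partial Clarke gradients are bounded through
    the Lipschitz constant [L], and the Gibbs mean inherits the bound with [L + 1]. *)

Lemma lebesgue_measure_affine (R : realType) (a t : R) (A : set (measurableTypeR R)) :
  0 < t -> measurable A ->
  lebesgue_measure ((fun x : measurableTypeR R => (a + t * x : measurableTypeR R)) @^-1` A) =
  (t^-1%:E * lebesgue_measure A)%E.
Proof.
move=> t0 mA.
pose f := fun x : measurableTypeR R => (a + t * x : measurableTypeR R).
have mf : measurable_fun setT f.
  by apply: measurable_funD => //; apply: measurable_funM => //.
pose nu := mscale (NngNum (ltW t0))
  (measure_function_pushforward__canonical__measure_function_Measure (@lebesgue_measure R) mf).
have nuE : forall X, measurable X -> lebesgue_measure X = nu X.
  apply: lebesgue_measure_unique => _ [[c d] _ <-] /=.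
  rewrite /nu /mscale /= /pushforward.
  have -> : f @^-1` `]c, d] = `](c - a) / t, (d - a) / t]%classic.
    apply/seteqP; split => x /=; rewrite !in_itv/= /f.
      by move=> /andP[h1 h2]; rewrite ltr_pdivrMr// ler_pdivlMr//; lra.
    by rewrite ltr_pdivrMr// ler_pdivlMr// => /andP[h1 h2]; lra.
  rewrite !lebesgue_measure_itv/= !lte_fin ltr_pM2r ?invr_gt0// ltrD2r.
  case: ifPn => _; last by rewrite mule0.
  rewrite -!EFinB -EFinM; congr EFin.
  field; exact: lt0r_neq0.
rewrite (nuE _ mA) /nu /mscale /= /pushforward muleA -EFinM mulVf ?gt_eqF// mul1e.
by [].
Qed.

Definition tuple_affine (R : realType) (m : nat) (a : m.-tuple (measurableTypeR R)) (t : R)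
    (s : m.-tuple (measurableTypeR R)) : m.-tuple (measurableTypeR R) :=
  [tuple tnth a i + t * tnth s i | i < m].

(** Slicing along the first coordinate: the induction hypothesis scales each slice by [t^-1 ^+ m],
    and the one-dimensional change of variables in the outer integral supplies the last factor
    [t^-1]. *)
Lemma lebesgue_tuple_affine (R : realType) (m : nat)
    (a : m.-tuple (measurableTypeR R)) (t : R) (A : set (m.-tuple (measurableTypeR R))) :
  0 < t -> measurable A ->
  lebesgue_tuple (tuple_affine a t @^-1` A) = ((t^-1 ^+ m)%:E * lebesgue_tuple A)%E.
Proof.
move=> t0; elim: m a A => [|m IH] a A mA.
  rewrite expr0 mul1e /=.
  congr (dirac _ _); apply/seteqP; split => s /=; by rewrite (tuple0 s) (tuple0 (tuple_affine _ _ _)).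
have mcA : measurable (@consT R m @^-1` A).
  by rewrite -[X in measurable X]setTI; exact: measurable_consT.
pose a0 := thead a; pose a' := [tuple of behead a].
pose h := fun x : measurableTypeR R => lebesgue_tuple (xsection (@consT R m @^-1` A) x).
pose f := fun x : measurableTypeR R => (a0 + t * x : measurableTypeR R).
have mf : measurable_fun setT f.
  by apply: measurable_funD => //; apply: measurable_funM => //.
have mh : measurable_fun [set: measurableTypeR R] (h : measurableTypeR R -> \bar R).
  exact: measurable_fun_xsection.
have h0 x : (0 <= h x)%E by exact: measure_ge0.
transitivity (\int[@lebesgue_measure R]_x ((t^-1 ^+ m)%:E * h (f x)))%E.
  rewrite /= /pushforward /product_measure1; apply: eq_integral => x _ /=.
  rewrite -(IH a') /h; last exact: measurable_xsection.
  congr lebesgue_tuple; apply/seteqP; split => s.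
    move=> /xsectionP /= H; apply/xsectionP => /=.
    suff -> : consT (f x, tuple_affine a' t s) = tuple_affine a t (consT (x, s)) by [].
    apply: eq_from_tnth => i; rewrite tnth_mktuple.
    case: (unliftP ord0 i) => [j ->|->].
      by rewrite (tuple_eta a) !tnthS tnth_mktuple.
    by rewrite (tuple_eta a) !tnth0.
  move=> /= /xsectionP /= H; apply/xsectionP => /=.
  suff -> : tuple_affine a t (consT (x, s)) = consT (f x, tuple_affine a' t s) by [].
  apply: eq_from_tnth => i; rewrite tnth_mktuple.
  case: (unliftP ord0 i) => [j ->|->].
    by rewrite (tuple_eta a) !tnthS tnth_mktuple.
  by rewrite (tuple_eta a) !tnth0.
have tm0 : 0 <= t^-1 ^+ m by rewrite exprn_ge0// invr_ge0 ltW.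
rewrite ge0_integralZl//; last first.
  exact: measurableT_comp.
rewrite exprSr EFinM -muleA; congr (_ * _)%E.
transitivity (\int[pushforward (@lebesgue_measure R) f]_y h y)%E.
  by rewrite ge0_integral_pushforward// preimage_setT.
have t10 : 0 <= t^-1 by rewrite invr_ge0 ltW.
rewrite (_ : _ * _ = \int[mscale (NngNum t10) (@lebesgue_measure R)]_y h y)%E; last first.
  by rewrite ge0_integral_mscale.
apply: eq_measure_integral => B mB _ /=.
by rewrite /mscale /= /pushforward lebesgue_measure_affine.
Qed.

Lemma measurable_borel_rV_open (R : realType) (m : nat) (U : set 'rV[R]_m) :
  open U -> measurable (U : set (borel_rV R m)).
Proof. by move=> oU; exact: sub_sigma_algebra. Qed.

Lemma measurable_borel_rV_closed (R : realType) (m : nat) (Y : set 'rV[R]_m) :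
  closed Y -> measurable (Y : set (borel_rV R m)).
Proof.
move=> cY; rewrite -[Y]setCK; apply: measurableC; apply: measurable_borel_rV_open.
exact: closed_openC.
Qed.

Lemma measurable_borel_rV_compact (R : realType) (m : nat) (Y : set 'rV[R]_m) :
  compact Y -> measurable (Y : set (borel_rV R m)).
Proof.
by move=> /(compact_closed (@norm_hausdorff _ _)); exact: measurable_borel_rV_closed.
Qed.

Lemma lebesgue_rV_affine (R : realType) (m : nat) (a : 'rV[R]_m) (t : R)
    (A : set (borel_rV R m)) :
  0 < t -> measurable A ->
  lebesgue_rV ((fun y : 'rV[R]_m => a + t *: y) @^-1` A) =
  ((t^-1 ^+ m)%:E * lebesgue_rV A)%E.
Proof.
move=> t0 mA; rewrite /lebesgue_rV /pushforward.
rewrite -(lebesgue_tuple_affine [tuple a 0 i | i < m] t0); last first.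
  by rewrite -[X in measurable X]setTI; exact: measurable_row_of_tuple.
congr lebesgue_tuple; apply/seteqP; split => s /=; rewrite /preimage /=;
  (suff -> : a + t *: row_of_tuple s =
    row_of_tuple (tuple_affine [tuple a 0 i | i < m] t s) by []);
  by apply/rowP => i; rewrite !mxE !tnth_mktuple.
Qed.

Lemma measurable_tuple_box (R : realType) (m : nat) (M : R) :
  measurable [set s : m.-tuple (measurableTypeR R) | forall i, `|tnth s i| <= M].
Proof.
rewrite (_ : [set _ | _] = \bigcap_(i in [set: 'I_m])
    (@tnth m (measurableTypeR R) ^~ i) @^-1` [set` `[- M, M]]).
  apply: fin_bigcap_measurable => // i _; rewrite -[X in measurable X]setTI.
  by apply: measurable_tnth => //; exact: measurable_itv.
apply/seteqP; split => [t pt i _|t pt i] /=.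
  by have := pt i; rewrite /= in_itv/= ler_norml.
by have := pt i Logic.I; rewrite /= in_itv/= ler_norml.
Qed.

Lemma lebesgue_tuple_box_lty (R : realType) (m : nat) (M : R) :
  (lebesgue_tuple [set s : m.-tuple (measurableTypeR R) | forall i, (`|tnth s i| <= M)%R] < +oo)%E.
Proof.
elim: m => [|m IH].
  rewrite /= diracE; apply: (@le_lt_trans _ _ 1%E); last exact: ltry.
  by rewrite lee_fin; case: (_ \in _).
rewrite /= /pushforward.
have -> : @consT R m @^-1` [set s | forall i, `|tnth s i| <= M] =
    `[-M, M]%classic `*` [set s | forall i, `|tnth s i| <= M].
  apply/seteqP; split => -[x s] /=.
    move=> H; split => [|i].
      by have := H ord0; rewrite tnth0 in_itv/= ler_norml.
    by have := H (lift ord0 i); rewrite tnthS.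
  move=> [xM sM] i; case: (unliftP ord0 i) => [j ->|->].
    by rewrite tnthS.
  by rewrite tnth0 ler_norml; move: xM; rewrite in_itv.
have mB := @measurable_tuple_box R m M.
rewrite product_measure1E//.
rewrite lte_mul_pinfty//.
by have := @lebesgue_measure_itv R `[-M, M]; rewrite /= => ->; case: ifP.
Qed.

Lemma row_coord_le_norm (R : realType) (d : nat) (u : 'rV[R]_d) i : `|u 0 i| <= `|u|.
Proof.
rewrite [leRHS]/Num.norm /= mx_normrE; apply/bigmax_geP; right => /=.
by exists (0, i).
Qed.

Lemma lebesgue_rV_compact_lty (R : realType) (m : nat) (Y : set 'rV[R]_m) :
  compact Y -> (lebesgue_rV Y < +oo)%E.
Proof.
move=> cY; have mY := measurable_borel_rV_compact cY.
have [M [_ YM]] := compact_bounded cY.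
apply: (le_lt_trans _ (@lebesgue_tuple_box_lty R m (M + 1))).
rewrite /lebesgue_rV /pushforward.
apply: (@le_measure _ _ _ (lebesgue_tuple (R := R) (m := m))); rewrite ?inE.
- by rewrite -[X in measurable X]setTI; exact: measurable_row_of_tuple.
- exact: measurable_tuple_box.
- move=> s /= Ys i; have := YM (M + 1); rewrite ltrDl ltr01 => /(_ isT _ Ys) H.
  apply: le_trans H; have := row_coord_le_norm (row_of_tuple s) i.
  by rewrite mxE.
Qed.

Lemma convex_setP (R : realType) (d : nat) (A : set 'rV[R]_d) :
  convex_set A -> forall (x y : 'rV[R]_d) (t : R), 0 <= t -> t <= 1 -> A x -> A y ->
  A (t *: x + (1 - t) *: y).
Proof.
move=> cA x y t t0 t1 Ax Ay.
have t01 : Itv.spec (@Itv.num_sem R) (Itv.Real `[0%Z, 1%Z]) t.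
  by rewrite /= /Itv.num_sem ger0_real//= in_itv/= t0.
have := cA x y (Itv.mk t01); rewrite !inE => /(_ Ax Ay).
by [].
Qed.

(* A homothety of small ratio centred at y0 maps Y into Y `&` U. *)
Lemma lebesgue_rV_convex_open_gt0 (R : realType) (m : nat) (Y U : set 'rV[R]_m) (y0 : 'rV[R]_m) :
  compact Y -> convex_set Y -> (0 < lebesgue_rV Y)%E -> open U -> Y y0 -> U y0 ->
  (0 < lebesgue_rV (Y `&` U))%E.
Proof.
move=> cY cvY Y0 oU Yy0 Uy0.
have mYU : measurable (Y `&` U : set (borel_rV R m)).
  by apply: measurableI; [exact: measurable_borel_rV_compact|exact: measurable_borel_rV_open].
have [M [_ YM]] := compact_bounded cY.
have M1 y : Y y -> `|y| <= `|M| + 1.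
  by move=> Yy; apply: YM => //; apply: (le_lt_trans (ler_norm _)); rewrite ltrDl.
have /nbhs_ballP[e /= e0 eU] : nbhs y0 U by exact: open_nbhs_nbhs.
pose K := 2 * (`|M| + 1).
have K0 : 0 < K by rewrite mulr_gt0// ltr_wpDl.
pose t := Num.min 1 (e / 2 / K).
have t0 : 0 < t by rewrite lt_min ltr01 !divr_gt0.
have t1 : t <= 1 by rewrite ge_min lexx.
have tK : t * K < e.
  have : t <= e / 2 / K by rewrite ge_min lexx orbT.
  rewrite ler_pdivlMr//; lra.
pose f (y : 'rV[R]_m) := (1 - t) *: y0 + t *: y.
have sub : Y `<=` f @^-1` (Y `&` U).
  move=> y Yy; split.
    by rewrite /f addrC; apply: convex_setP => //; exact: ltW.
  apply: eU; rewrite -ball_normE /= /f scalerBl scale1r -addrA opprD addNKr opprD opprK.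
  rewrite -scalerBr normrZ gtr0_norm// (le_lt_trans _ tK)// ler_pM2l//.
  by rewrite (le_trans (ler_normB _ _))// /K mulr2n mulrDl !mul1r lerD// M1.
have mA : measurable (f @^-1` (Y `&` U) : set (borel_rV R m)).
  have cf : continuous f.
    by move=> y; apply: (@continuousD _ _ _ (cst ((1 - t) *: y0)) ( *:%R t));
      [exact: cst_continuous|exact: scaler_continuous].
  rewrite preimage_setI; apply: measurableI.
    apply: measurable_borel_rV_closed; apply: closed_comp => //.
    exact: compact_closed (@norm_hausdorff _ _) cY.
  by apply: measurable_borel_rV_open; exact: open_comp.
have := lebesgue_rV_affine ((1 - t) *: y0) t0 mYU.
have Yle : (lebesgue_rV Y <= lebesgue_rV (f @^-1` (Y `&` U)))%E.
  apply: le_measure => //; rewrite inE//; exact: measurable_borel_rV_compact.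
move=> E.
suff : lebesgue_rV (Y `&` U) != 0%E by rewrite lt0e measure_ge0 andbT.
by move: (lt_le_trans Y0 Yle); rewrite E; apply: contraTN => /eqP ->; rewrite mule0 ltxx.
Qed.

Lemma measurable_fun_borel_rV (R : realType) (m : nat) (Y : set 'rV[R]_m) (f : 'rV[R]_m -> R) :
  compact Y -> {within Y, continuous f} ->
  measurable_fun (Y : set (borel_rV R m)) (f : borel_rV R m -> R).
Proof.
move=> cY /continuousP cf; apply: (measurability _ (RGenOpens.measurableE R)).
move=> _ [_ [a [b ->] <-]].
have /cf/open_subspaceP[V oV VE] : open (`]a, b[%classic : set R) by exact: interval_open.
rewrite setIC -VE; apply: measurableI; last exact: measurable_borel_rV_compact.
exact: measurable_borel_rV_open.
Qed.

Lemma integrable_borel_rV (R : realType) (m : nat) (Y : set 'rV[R]_m) (f : 'rV[R]_m -> R) :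
  compact Y -> (forall y, Y y -> {for y, continuous f}) ->
  (@lebesgue_rV R m).-integrable Y (EFin \o f).
Proof.
move=> cY cf.
have cfY : {within Y, continuous f}.
  by apply/subspace_continuousP => y Yy; apply: cvg_within_filter; exact: cf.
apply: measurable_bounded_integrable.
- exact: measurable_borel_rV_compact.
- exact: lebesgue_rV_compact_lty.
- exact: measurable_fun_borel_rV.
- have /compact_bounded[M [Mr MY]] := continuous_compact cfY cY.
  exists M; split => // x Mx y Yy; apply: (MY x Mx); by exists y.
Qed.

(** [k] is the volume of the part of [Y] inside [U]. It is fixed before [f], because [f] will be a
    Gibbs weight that varies with [mu] and [x] while [k] must not. *)
Lemma Rintegral_borel_rV_gt (R : realType) (m : nat) (Y U : set 'rV[R]_m) (y0 : 'rV[R]_m) :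
  compact Y -> convex_set Y -> (0 < lebesgue_rV Y)%E -> open U -> Y y0 -> U y0 ->
  exists2 k : R, 0 < k & forall (f : 'rV[R]_m -> R) (a : R),
    (forall y, Y y -> {for y, continuous f}) ->
    (forall y, Y y -> 0 <= f y) -> (forall y, Y y -> U y -> a <= f y) ->
    k * a <= \int[@lebesgue_rV R m]_(y in Y) f y.
Proof.
move=> cY cvY Y0 oU Yy0 Uy0.
have YU0 := lebesgue_rV_convex_open_gt0 cY cvY Y0 oU Yy0 Uy0.
have mY := measurable_borel_rV_compact cY.
have mYU : measurable (Y `&` U : set (borel_rV R m)).
  by apply: measurableI => //; exact: measurable_borel_rV_open.
have YUle : (lebesgue_rV (Y `&` U) <= lebesgue_rV Y)%E.
  by apply: le_measure; rewrite ?inE//; exact: subIsetl.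
have YUoo := le_lt_trans YUle (lebesgue_rV_compact_lty cY).
exists (fine (lebesgue_rV (Y `&` U))); first by rewrite fine_gt0// YU0.
move=> f a cf f0 fa.
have If := integrable_borel_rV cY cf.
have IfU : (@lebesgue_rV R m).-integrable (Y `&` U) (EFin \o f).
  by apply: integrableS If => //; exact: subIsetl.
rewrite mulrC -Rintegral_cst//.
apply: (@le_trans _ _ (\int[@lebesgue_rV R m]_(y in Y `&` U) f y)).
  apply: le_Rintegral => //; last by move=> y [Yy Uy]; exact: fa.
  apply: measurable_bounded_integrable => //.
  exists `|a|; split; first exact: num_real.
  by move=> M aM y _; rewrite /= ltW.
rewrite /Rintegral fine_le//; [exact: integrable_fin_num|exact: integrable_fin_num|].
apply: ge0_subset_integral => //.
  by case/integrableP : If.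
Qed.

(** * Gradients and differentiation under the integral sign *)

Lemma differentiable_littleo (R : numFieldType) (V W : normedModType R) (f : V -> W)
    (df : {linear V -> W}) (x : V) :
  continuous df ->
  (forall e, 0 < e -> \forall h \near (0 : V), `|f (h + x) - f x - df h| <= e * `|h|) ->
  differentiable f x /\ 'd f x = df :> (V -> W).
Proof.
move=> cdf H.
have fE : f \o shift x = cst (f x) + df +o_ (0 : V) id.
  apply/eqaddoP => e e0; apply: filterS (H _ e0) => h.
  by rewrite /= -[(_ - _) h]/(f (h + x) - (f x + df h)) opprD addrA.
have dE := diff_unique cdf fE.
by split => //; apply/diff_locallyP; rewrite dE.
Qed.

Lemma diff_grad (R : realType) (d : nat) (f : 'rV[R]_d -> R) (z u : 'rV[R]_d) :
  differentiable f z -> 'd f z u = dotv (grad f z) u.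
Proof.
move=> df; rewrite [in LHS](row_sum_delta u) linear_sum; apply: eq_bigr => i _.
by rewrite linearZ /= mxE deriveE// mulrC.
Qed.

Lemma dotv_linear (R : realType) (d : nat) (w : 'rV[R]_d) : linear (dotv w).
Proof.
move=> a u v; rewrite /dotv scaler_sumr -big_split; apply: eq_bigr => i _ /=.
by rewrite !mxE mulrDr; congr (_ + _); rewrite mulrCA.
Qed.

HB.instance Definition _ (R : realType) (d : nat) (w : 'rV[R]_d) :=
  GRing.isLinear.Build R 'rV[R]_d R _ (dotv w) (dotv_linear w).

Lemma dotvC (R : realType) (d : nat) (u v : 'rV[R]_d) : dotv u v = dotv v u.
Proof. by apply: eq_bigr => i _; rewrite mulrC. Qed.

Lemma dotvBl (R : realType) (d : nat) (u v w : 'rV[R]_d) :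
  dotv (u - v) w = dotv u w - dotv v w.
Proof. by rewrite !(dotvC _ w) linearB. Qed.

Lemma dotvZl (R : realType) (d : nat) (a : R) (u v : 'rV[R]_d) :
  dotv (a *: u) v = a * dotv u v.
Proof. by rewrite !(dotvC _ v) linearZ. Qed.

Lemma normr_dotv_le (R : realType) (d : nat) (w u : 'rV[R]_d) (e : R) :
  (forall i, `|w 0 i| <= e) -> `|dotv w u| <= d%:R * e * `|u|.
Proof.
move=> we; apply: (le_trans (ler_norm_sum _ _ _)).
apply: (@le_trans _ _ (\sum_(i < d) e * `|u|)).
  apply: ler_sum => i _; rewrite normrM ler_pM//.
  exact: row_coord_le_norm.
by rewrite sumr_const card_ord -mulrA mulr_natl.
Qed.

Lemma dotv_continuous (R : realType) (d : nat) (w : 'rV[R]_d) : continuous (dotv w).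
Proof.
move=> u; apply/(@cvgrPdist_le _ _ _ (nbhs u) (nbhs_filter u)) => e e0.
pose K := d%:R * `|w| + 1.
have K0 : 0 < K by rewrite ltr_wpDl// mulr_ge0.
near=> v.
rewrite -linearB.
apply: (le_trans (normr_dotv_le _ (row_coord_le_norm w))).
apply: (@le_trans _ _ (K * `|u - v|)); first by rewrite ler_wpM2r// lerDl.
rewrite -ler_pdivlMl// mulrC.
near: v; apply/nbhs_ballP; exists (e / K); first exact: divr_gt0.
by move=> v; rewrite -ball_normE => /ltW.
Unshelve. all: by end_near. Qed.

Lemma MVT_row (R : realType) (d : nat) (f : 'rV[R]_d -> R) (z w : 'rV[R]_d) :
  (forall t : R, 0 <= t <= 1 -> differentiable f (z + t *: w)) ->
  exists2 c, 0 <= c <= 1 & f (z + w) - f z = dotv (grad f (z + c *: w)) w.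
Proof.
move=> df; pose phi (t : R) := f (z + t *: w).
have dphi (t : R) : 0 <= t <= 1 -> is_derive t 1 phi (dotv (grad f (z + t *: w)) w).
  move=> t01; have Hd := df _ t01.
  have dl : is_diff t (fun s : R => z + s *: w) (fun s => s *: w).
    have h1 := is_diff_scalel t w.
    have := is_diffD (is_diff_cst z (t : R^o)) h1; rewrite add0r; exact.
  have dcomp : differentiable phi t.
    by apply: (@differentiable_comp _ _ _ _ (fun s : R => z + s *: w) f).
  apply: DeriveDef; first exact: diff_derivable.
  rewrite deriveE// (@diff_comp _ _ _ _ (fun s : R => z + s *: w) f)//=.
  by rewrite diff_val scale1r diff_grad.
have [||c c01 E] := @MVT_segment R phi (fun t => dotv (grad f (z + t *: w)) w) 0 1 ler01.
- by move=> t /itvP ht; apply: dphi; rewrite !ht.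
- apply/subspace_continuousP => t /=; rewrite in_itv/= => t01; apply: cvg_within_filter.
  apply: differentiable_continuous; apply/derivable1_diffP.
  by have [] := dphi _ t01.
- exists c; first by move: c01; rewrite in_itv.
  by rewrite -{1}[w]scale1r -[X in _ - f X]addr0 -(scale0r w) -/(phi 1) -/(phi 0) E subr0 mulr1.
Qed.

Lemma near_row_mx (R : realType) (n m : nat) (x : 'rV[R]_n) (y : 'rV[R]_m)
    (P : set 'rV[R]_(n + m)) :
  nbhs (row_mx x y) P -> \forall x' \near x & y' \near y, P (row_mx x' y').
Proof.
move=> /nbhs_ballP[e /= e0 eP].
exists (ball x e, ball y e) => /=; first by split; exact: nbhsx_ballx.
move=> [x' y'] [/= [_ xx'] [_ yy']]; apply: eP; split=> // i j.
by rewrite !mxE; case: splitP => k _.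
Qed.

(** Around each [y], both [h (row_mx x' y')] and [h (row_mx x y')] are within [e / 2] of
    [h (row_mx x y)]; compactness of [Y] makes the neighborhood of [x] common to all [y]. *)
Lemma uniform_near_compact (R : realType) (n m : nat) (Y : set 'rV[R]_m)
    (h : 'rV[R]_(n + m) -> R) (x : 'rV[R]_n) (e : R) :
  compact Y -> (forall y, Y y -> {for row_mx x y, continuous h}) -> 0 < e ->
  \forall x' \near x, forall y, Y y -> `|h (row_mx x' y) - h (row_mx x y)| < e.
Proof.
move=> /compact_near_coveringP cY ch e0.
apply: (cY _ (nbhs x) (fun x' y => `|h (row_mx x' y) - h (row_mx x y)| < e)) => y Yy.
have e20 : 0 < e / 2 by rewrite divr_gt0.
have /near_row_mx [[A B] /= [nA nB] AB] : nbhs (row_mx x y) [set z | `|h (row_mx x y) - h z| < e / 2].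
  exact: (@cvgr_dist_lt _ _ _ (nbhs (row_mx x y)) _ h (h (row_mx x y)) (ch y Yy) _ e20).
exists (B, A) => //= -[y' x'] [/= By' Ax'].
have h1 := AB (x', y') (conj Ax' By').
have h2 := AB (x, y') (conj (nbhs_singleton nA) By').
rewrite /= in h1 h2.
rewrite -(subrKA (h (row_mx x y))) (splitr e).
apply: (le_lt_trans (ler_normD _ _)); rewrite distrC ltrD//.
Qed.

Lemma continuous_row_mxr (R : realType) (n m : nat) (x : 'rV[R]_n) :
  continuous (fun y : 'rV[R]_m => row_mx x y).
Proof.
move=> y P /near_row_mx[[A B] /= [nA nB] AB]; apply: filterS nB => y' By'.
by apply: (AB (x, y')); split => //; exact: nbhs_singleton.
Qed.

Lemma open_rVprod (R : realType) (n m : nat) (A : set 'rV[R]_n) (B : set 'rV[R]_m) :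
  open A -> open B -> open (rVprod A B).
Proof.
move=> oA oB; rewrite openE => z [/= Az Bz].
have /nbhs_ballP[e /= e0 eA] : nbhs (lsubmx z) A by exact: open_nbhs_nbhs.
have /nbhs_ballP[e' /= e'0 eB] : nbhs (rsubmx z) B by exact: open_nbhs_nbhs.
apply/nbhs_ballP; exists (Num.min e e') => /=; first by rewrite lt_min e0.
move=> w [_ zw]; split.
  apply: eA; split => // i j; rewrite !mxE; apply: le_ball (zw _ _).
  by rewrite ge_min lexx.
apply: eB; split => // i j; rewrite !mxE; apply: le_ball (zw _ _).
by rewrite ge_min lexx orbT.
Qed.

Lemma dotv_row_mx0 (R : realType) (n m : nat) (w : 'rV[R]_(n + m)) (u : 'rV[R]_n) :
  dotv w (row_mx u 0) = dotv (lsubmx w) u.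
Proof.
rewrite /dotv big_split_ord /= [X in _ + X]big1 ?addr0 => [|i _].
  by apply: eq_bigr => i _; rewrite row_mxEl mxE.
by rewrite row_mxEr mxE mulr0.
Qed.

Lemma Rintegral_dotv d (T : measurableType d) (R : realType)
    (mu : {measure set T -> \bar R}) (D : set T) (n : nat) (w : T -> 'rV[R]_n) (u : 'rV[R]_n) :
  measurable D -> (forall i, mu.-integrable D (EFin \o (fun y => w y 0 i))) ->
  mu.-integrable D (EFin \o (fun y => dotv (w y) u)) /\
  \int[mu]_(y in D) dotv (w y) u = dotv (\row_i \int[mu]_(y in D) w y 0 i) u.
Proof.
move=> mD wint; rewrite /dotv.
suff H (s : seq 'I_n) : mu.-integrable D (EFin \o (fun y => \sum_(i <- s) w y 0 i * u 0 i)) /\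
    \int[mu]_(y in D) (\sum_(i <- s) w y 0 i * u 0 i) =
    \sum_(i <- s) (\int[mu]_(y in D) w y 0 i) * u 0 i.
  have [H1 H2] := H (index_enum 'I_n); split => //.
  by rewrite H2; apply: eq_bigr => i _; rewrite mxE.
elim: s => [|i s [IH1 IH2]].
  split.
    rewrite (_ : _ \o _ = cst 0%E); first exact: integrable0.
    by apply/funext => y; rewrite /= big_nil.
  rewrite big_nil; under eq_Rintegral do rewrite big_nil.
  by rewrite Rintegral_cst// mul0r.
have wi : mu.-integrable D (EFin \o (fun y => w y 0 i * u 0 i)).
  have := integrableZr mD (u 0 i) (wint i).
  by congr (_.-integrable _ _); apply/funext => y.
split.
  have := integrableD mD wi IH1.
  by congr (_.-integrable _ _); apply/funext => y /=; rewrite big_cons EFinD.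
rewrite big_cons -IH2 -RintegralZr// -RintegralD//.
by under eq_Rintegral do rewrite big_cons.
Qed.

Section differentiation_under_integral.
Context (R : realType) (n m : nat).
Variables (OX : set 'rV[R]_n) (OY Y : set 'rV[R]_m) (h : 'rV[R]_(n + m) -> R).
Hypotheses (oOX : open OX) (oOY : open OY) (YOY : Y `<=` OY) (cY : compact Y)
  (dh : cont_differentiable (rVprod OX OY) h).

Let F x := \int[@lebesgue_rV R m]_(y in Y) h (row_mx x y).
Let G x : 'rV[R]_n :=
  \row_i \int[@lebesgue_rV R m]_(y in Y) grad h (row_mx x y) 0 (lshift m i).

Let in_prod x y : OX x -> Y y -> rVprod OX OY (row_mx x y).
Proof. by move=> Ox Yy; rewrite /rVprod/= row_mxKl row_mxKr; split => //; exact: YOY. Qed.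

Let grad_cont x y (i : 'I_(n + m)) : OX x -> Y y ->
  {for row_mx x y, continuous (fun z => grad h z 0 i)}.
Proof.
move=> Ox Yy; have [_ cg] := dh (in_prod Ox Yy).
apply: (@continuous_comp _ _ _ (grad h) (fun u : 'rV[R]_(n + m) => u 0 i)) => //.
exact: coord_continuous.
Qed.

Let h_cont x y : OX x -> Y y -> {for row_mx x y, continuous h}.
Proof. by move=> Ox Yy; have [/differentiable_continuous + _] := dh (in_prod Ox Yy). Qed.

Let h_int x : OX x -> (@lebesgue_rV R m).-integrable Y (EFin \o (fun y => h (row_mx x y))).
Proof.
move=> Ox; apply: integrable_borel_rV => // y Yy.
apply: (@continuous_comp _ _ _ (fun y => row_mx x y) h); first exact: continuous_row_mxr.
exact: h_cont.
Qed.

Let grad_int x i : OX x -> (@lebesgue_rV R m).-integrable Y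
  (EFin \o (fun y => grad h (row_mx x y) 0 i)).
Proof.
move=> Ox; apply: integrable_borel_rV => // y Yy.
apply: (@continuous_comp _ _ _ (fun y => row_mx x y) (fun z => grad h z 0 i)).
  exact: continuous_row_mxr.
exact: grad_cont.
Qed.

Let uniform_grad x e : OX x -> 0 < e -> \forall x' \near x, forall y, Y y -> forall i : 'I_n,
  `|grad h (row_mx x' y) 0 (lshift m i) - grad h (row_mx x y) 0 (lshift m i)| < e.
Proof.
move=> Ox e0.
have H i := @uniform_near_compact R n m Y (fun z => grad h z 0 (lshift m i)) x e
  cY (fun y Yy => grad_cont Ox Yy) e0.
have := @filter_forall _ _ (fun i x' => forall y, Y y ->
    `|grad h (row_mx x' y) 0 (lshift m i) - grad h (row_mx x y) 0 (lshift m i)| < e)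
  (nbhs x) (nbhs_filter x) H.
by apply: filterS => x' H' y Yy i; exact: H'.
Qed.

(** The mean value theorem in the [x] direction turns a uniform modulus of the partial gradient into
    a first-order remainder uniform in [y], which can then be integrated over [Y]. *)
Let pointwise x u e : (forall t : R, 0 <= t <= 1 -> OX (x + t *: u)) -> OX x ->
  (forall t : R, 0 <= t <= 1 -> forall y, Y y -> forall i : 'I_n,
   `|grad h (row_mx (x + t *: u) y) 0 (lshift m i) - grad h (row_mx x y) 0 (lshift m i)| < e) ->
  forall y, Y y ->
  `|h (row_mx (u + x) y) - h (row_mx x y) - dotv (lsubmx (grad h (row_mx x y))) u| <= n%:R * e * `|u|.
Proof.
move=> Ou Ox He y Yy.
have rE (t : R) : row_mx x y + t *: row_mx u 0 = row_mx (x + t *: u) y.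
  by rewrite scale_row_mx scaler0 add_row_mx addr0.
have [t t01|t t01 E] := @MVT_row R _ h (row_mx x y) (row_mx u 0).
  by rewrite rE; have [] := dh (in_prod (Ou _ t01) Yy).
have -> : row_mx (u + x) y = row_mx x y + row_mx u 0 by rewrite add_row_mx addr0 addrC.
rewrite E rE dotv_row_mx0 -dotvBl.
by apply: normr_dotv_le => i; rewrite !mxE ltW//; have := He _ t01 y Yy i; rewrite !mxE.
Qed.

Lemma differentiable_integral x : OX x -> differentiable F x /\ grad F x = G x.
Proof.
move=> Ox.
have mY := measurable_borel_rV_compact cY.
suff [dF dE] : differentiable F x /\ 'd F x = dotv (G x) :> (_ -> _).
  split => //; apply/rowP => i; rewrite mxE deriveE// dE /dotv (bigD1 i)//= big1 ?addr0.
    by rewrite [delta_mx _ _ _ _]mxE !eqxx mulr1.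
  by move=> j ji; rewrite [delta_mx _ _ _ _]mxE (negbTE ji) andbF mulr0.
apply: (@differentiable_littleo _ _ _ F (dotv (G x)) x); first exact: dotv_continuous.
move=> e e0.
(* [K] exceeds [n] times the volume of [Y], the factor that the remainder acquires under
   integration. *)
pose K := n%:R * fine (@lebesgue_rV R m Y) + 1.
have K0 : 0 < K by rewrite ltr_wpDl// mulr_ge0// fine_ge0.
have eK0 : 0 < e / K by rewrite divr_gt0.
have /nbhs_ballP[d /= d0 Hd] : nbhs x ([set x' | forall y, Y y -> forall i : 'I_n,
    `|grad h (row_mx x' y) 0 (lshift m i) - grad h (row_mx x y) 0 (lshift m i)| < e / K] `&` OX).
  by apply: filterI; [exact: uniform_grad|exact: open_nbhs_nbhs].
have tball (u : 'rV[R]_n) (t : R) : `|u| < d -> 0 <= t <= 1 -> ball x d (x + t *: u).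
  move=> ud /andP[t0 t1]; rewrite -ball_normE /= opprD addNKr normrN normrZ ger0_norm//.
  by rewrite (le_lt_trans _ ud)// ler_piMl.
apply/nbhs_ballP; exists d => //= u; rewrite -ball_normE /= sub0r normrN => ud.
have Oux : OX (u + x).
  by have := (Hd _ (tball u 1 ud _)).2; rewrite scale1r addrC; apply; rewrite ler01 lexx.
have Hp := @pointwise x u (e / K) (fun t t01 => (Hd _ (tball u t ud t01)).2) Ox
  (fun t t01 => (Hd _ (tball u t ud t01)).1).
have gi i : (@lebesgue_rV R m).-integrable Y
    (EFin \o (fun y => lsubmx (grad h (row_mx x y)) 0 i)).
  have := grad_int (lshift m i) Ox; congr (_.-integrable _ _).
  by apply/funext => y; rewrite /= [in RHS]mxE.
have [dI dE] := Rintegral_dotv u mY gi.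
have -> : dotv (G x) u = \int[@lebesgue_rV R m]_(y in Y) dotv (lsubmx (grad h (row_mx x y))) u.
  rewrite dE; congr dotv; apply/rowP => i; rewrite !mxE.
  by apply: eq_Rintegral => y _; rewrite [in RHS]mxE.
have hB : (@lebesgue_rV R m).-integrable Y
    (EFin \o (fun y => h (row_mx (u + x) y) - h (row_mx x y))).
  have := integrableB mY (h_int Oux) (h_int Ox).
  by congr (_.-integrable _ _); apply/funext => y.
have hBB : (@lebesgue_rV R m).-integrable Y
    (EFin \o (fun y => h (row_mx (u + x) y) - h (row_mx x y) - dotv (lsubmx (grad h (row_mx x y))) u)).
  have := integrableB mY hB dI.
  by congr (_.-integrable _ _); apply/funext => y.
rewrite /F -RintegralB//; [|exact: h_int|exact: h_int].
rewrite -RintegralB//.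
apply: (le_trans (le_normr_Rintegral mY hBB)).
apply: (@le_trans _ _ (\int[@lebesgue_rV R m]_(y in Y) (n%:R * (e / K) * `|u|))).
  apply: le_Rintegral => //; first exact: integrable_norm.
  by apply: integrable_borel_rV => // y Yy; exact: cst_continuous.
rewrite Rintegral_cst//.
have -> : n%:R * (e / K) * `|u| * fine (lebesgue_rV Y) =
    (e * `|u|) * ((n%:R * fine (lebesgue_rV Y)) / K) by ring.
apply: ler_piMr; first by rewrite mulr_ge0// ltW.
by rewrite ler_pdivrMr// mul1r lerDl.
Qed.

Lemma continuous_grad_integral x : OX x -> {for x, continuous (grad F)}.
Proof.
move=> Ox.
have mY := measurable_borel_rV_compact cY.
apply/(@cvgrPdist_le _ _ _ (nbhs x) (nbhs_filter x)) => e e0.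
pose K := fine (@lebesgue_rV R m Y) + 1.
have K0 : 0 < K by rewrite ltr_wpDl// fine_ge0.
have eK0 : 0 < e / K by rewrite divr_gt0.
have : nbhs x ([set x' | forall y, Y y -> forall i : 'I_n,
    `|grad h (row_mx x' y) 0 (lshift m i) - grad h (row_mx x y) 0 (lshift m i)| < e / K] `&` OX).
  by apply: filterI; [exact: uniform_grad|exact: open_nbhs_nbhs].
apply: filterS => x' [Hx' Ox'].
rewrite (differentiable_integral Ox).2 (differentiable_integral Ox').2.
rewrite [leLHS]/Num.norm /= mx_normrE; apply: bigmax_le => [|[i j] _ /=]; first exact: ltW.
rewrite !mxE -RintegralB//; [|exact: grad_int|exact: grad_int].
have dint : (@lebesgue_rV R m).-integrable Y
    (EFin \o (fun y => grad h (row_mx x y) 0 (lshift m j) - grad h (row_mx x' y) 0 (lshift m j))).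
  have := integrableB mY (grad_int (lshift m j) Ox) (grad_int (lshift m j) Ox').
  by congr (_.-integrable _ _); apply/funext => y.
apply: (le_trans (le_normr_Rintegral mY dint)).
apply: (@le_trans _ _ (\int[@lebesgue_rV R m]_(y in Y) (e / K))).
  apply: le_Rintegral => //; first exact: integrable_norm.
    by apply: integrable_borel_rV => // y Yy; exact: cst_continuous.
  by move=> y Yy; rewrite distrC ltW// Hx'.
rewrite Rintegral_cst// mulrAC ler_pdivrMr// ler_pM2l//.
by rewrite lerDl.
Qed.

End differentiation_under_integral.

Lemma grad_comp (R : realType) (d : nat) (f : 'rV[R]_d -> R) (phi : R -> R) (dphi : R)
    (z : 'rV[R]_d) :
  differentiable f z -> is_derive (f z) 1 phi dphi ->
  differentiable (phi \o f) z /\ grad (phi \o f) z = dphi *: grad f z.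
Proof.
move=> df dp; have dphid : differentiable phi (f z) by apply/derivable1_diffP; exact: ex_derive.
have dc : differentiable (phi \o f) z by exact: differentiable_comp.
split => //; apply/rowP => i; rewrite !mxE !deriveE// diff_comp//=.
rewrite -[X in 'd phi _ X]mulr1 -[X in 'd phi _ X]/(_ *: (1 : R^o)) linearZ /=.
by rewrite -[X in _ *: X]deriveE// derive_val mulrC.
Qed.

Lemma cont_differentiable_comp (R : realType) (d : nat) (O : set 'rV[R]_d)
    (f : 'rV[R]_d -> R) (phi dphi : R -> R) :
  open O -> cont_differentiable O f ->
  (forall z, O z -> is_derive (f z) 1 phi (dphi (f z))) ->
  (forall z, O z -> {for f z, continuous dphi}) ->
  cont_differentiable O (phi \o f).
Proof.
move=> oO cf dp cdp z Oz; have [df cg] := cf z Oz.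
split; first exact: (grad_comp df (dp z Oz)).1.
have H : \forall w \near z, dphi (f w) *: grad f w = grad (phi \o f) w.
  apply: filterS (open_nbhs_nbhs (conj oO Oz)) => w Ow.
  by rewrite (grad_comp (cf w Ow).1 (dp w Ow)).2.
rewrite /prop_for /continuous_at (grad_comp df (dp z Oz)).2.
apply: cvg_trans (near_eq_cvg H) _.
apply: cvgZ; last exact: cg.
apply: (@continuous_comp _ _ _ f dphi); last exact: cdp.
exact: differentiable_continuous.
Qed.

(** Both sides are [lim] of the same difference quotients, so they agree even where the limits fail
    to exist. *)
Lemma gradxE (R : realType) (n m : nat) (g : 'rV[R]_(n + m) -> R) (x : 'rV[R]_n) (y : 'rV[R]_m) :
  gradx g x y = lsubmx (grad g (row_mx x y)).
Proof.
apply/rowP => i; rewrite !mxE /derive.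
set a := (X in lim (X @ _)); set b := (X in _ = lim (X @ _)).
suff -> : a = b by []; apply/funext => t; rewrite /a /b /=; congr (_ *: (g _ - _)).
rewrite (_ : delta_mx 0 (lshift m i) = row_mx (delta_mx 0 i) 0); last first.
  apply/rowP => j; rewrite !mxE; case: splitP => k jk; rewrite ?mxE.
    by rewrite -!val_eqE /= jk.
  have /negbTE -> : j != lshift m i; last by rewrite andbF.
  by rewrite -val_eqE /= jk gtn_eqF// (leq_trans (ltn_ord i))// leq_addr.
by rewrite scale_row_mx scaler0 add_row_mx add0r.
Qed.

(** * Smoothness of the entropic approximation and its gradient as a Gibbs mean *)

Section entropic.
Context (R : realType) (n m : nat).
Variables (OX : set 'rV[R]_n) (OY Y : set 'rV[R]_m) (g_ : R -> 'rV[R]_(n + m) -> R) (mu : R).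
Hypotheses (oOX : open OX) (oOY : open OY) (YOY : Y `<=` OY) (cY : compact Y)
  (cvY : convex_set Y) (Y0 : (0 < lebesgue_rV Y)%E)
  (mu0 : 0 < mu) (dg : cont_differentiable (rVprod OX OY) (g_ mu)).

Let h := fun z => expR (- mu^-1 * g_ mu z).

Let dphi (a s : R) : is_derive s 1 (fun s => expR (a * s)) (a * expR (a * s)).
Proof.
have := @is_derive1_comp R (expR) ( *%R a) s (expR (a * s)) a.
rewrite [a * expR _]mulrC; apply.
have := @is_deriveZ R R^o R^o id a s 1 1 (is_derive_id _ _); rewrite [_%:A]mulr1; exact.
Qed.

Let hC1 : cont_differentiable (rVprod OX OY) h.
Proof.
apply: (@cont_differentiable_comp _ _ _ (g_ mu) (fun s => expR (- mu^-1 * s))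
  (fun s => - mu^-1 * expR (- mu^-1 * s))) => //.
  exact: open_rVprod.
move=> z _; apply: cvgM; first exact: cvg_cst.
apply: (@continuous_comp _ _ _ ( *%R (- mu^-1)) expR); last exact: continuous_expR.
exact: mulrl_continuous.
Qed.

Let Z x := \int[@lebesgue_rV R m]_(y in Y) h (row_mx x y).

Let in_prod x y : OX x -> Y y -> rVprod OX OY (row_mx x y).
Proof. by move=> Ox Yy; rewrite /rVprod/= row_mxKl row_mxKr; split => //; exact: YOY. Qed.

Let h_cont x y : OX x -> Y y -> {for y, continuous (fun y => h (row_mx x y))}.
Proof.
move=> Ox Yy; apply: (@continuous_comp _ _ _ (fun y => row_mx x y) h).
  exact: continuous_row_mxr.
by have [/differentiable_continuous + _] := hC1 (in_prod Ox Yy).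
Qed.

Lemma partition_gt0 x : OX x -> 0 < Z x.
Proof.
move=> Ox.
have [y0 Yy0] : Y !=set0.
  by apply/set0P; apply: contraTneq Y0 => ->; rewrite measure0 ltxx.
have cfY : {within Y, continuous (fun y => h (row_mx x y))}.
  by apply/subspace_continuousP => y Yy; apply: cvg_within_filter; exact: h_cont.
have [c _ hc] := compact_EVT_min (ex_intro _ y0 Yy0) cY cfY.
have [k k0 Hk] := Rintegral_borel_rV_gt cY cvY Y0 openT Yy0 Logic.I.
apply: (@lt_le_trans _ _ (k * h (row_mx x c))); first by rewrite mulr_gt0// expR_gt0.
apply: Hk => [y Yy|y Yy|y Yy _]; [exact: h_cont|exact: expR_ge0|].
by apply: hc; rewrite inE.
Qed.

Let dln (s : R) : 0 < s -> is_derive s 1 (fun s => - mu * ln s) (- mu * s^-1).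
Proof.
move=> s0; have := @is_deriveZ R R^o R^o (@ln R) (- mu) s 1 s^-1 (is_derive1_ln s0).
by exact.
Qed.

Let entropicE : entropic Y g_ mu = (fun s => - mu * ln s) \o Z.
Proof. by []. Qed.

Lemma cont_differentiable_entropic : cont_differentiable OX (entropic Y g_ mu).
Proof.
rewrite entropicE; apply: (@cont_differentiable_comp _ _ _ _ _ (fun s => - mu * s^-1)) => //.
- move=> x Ox; split; last exact: (continuous_grad_integral oOX YOY cY hC1).
  exact: (differentiable_integral oOX YOY cY hC1 Ox).1.
- by move=> x Ox; apply: dln; exact: partition_gt0.
- move=> x Ox; apply: cvgM; first exact: cvg_cst.
  by apply: inv_continuous; rewrite gt_eqF// partition_gt0.
Qed.

(** The gradient is the Gibbs mean of [gradx], so the left side is the integral over [Y] of the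
    quantity bounded by [B]. Keeping the factor [Z x] lets a small [B] be compared later with a
    lower bound of [Z x]; [B = 0] gives plain bounds on the mean. *)
Lemma grad_entropic_le x u c B : OX x ->
  (forall y, Y y -> h (row_mx x y) * (dotv (gradx (g_ mu) x y) u - c) <= B) ->
  (dotv (grad (entropic Y g_ mu) x) u - c) * Z x <= B * fine (@lebesgue_rV R m Y).
Proof.
move=> Ox HB; have mY := measurable_borel_rV_compact cY.
have gi i : (@lebesgue_rV R m).-integrable Y
    (EFin \o (fun y => lsubmx (grad h (row_mx x y)) 0 i)).
  apply: integrable_borel_rV => // y Yy.
  rewrite (_ : (fun _ => _) = fun y => grad h (row_mx x y) 0 (lshift m i)); last first.
    by apply/funext => y'; rewrite mxE.
  apply: (@continuous_comp _ _ _ (fun y => row_mx x y) (fun z => grad h z 0 (lshift m i))).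
    exact: continuous_row_mxr.
  apply: (@continuous_comp _ _ _ (grad h) (fun u : 'rV[R]_(n + m) => u 0 (lshift m i))).
    by have [] := hC1 (in_prod Ox Yy).
  exact: coord_continuous.
have [dI dE] := Rintegral_dotv u mY gi.
have [dZ gZ] := differentiable_integral oOX YOY cY hC1 Ox.
have gh y : Y y -> dotv (lsubmx (grad h (row_mx x y))) u =
    - mu^-1 * (h (row_mx x y) * dotv (gradx (g_ mu) x y) u).
  move=> Yy; have [dg1 _] := dg (in_prod Ox Yy).
  have -> : grad h (row_mx x y) = (- mu^-1 * h (row_mx x y)) *: grad (g_ mu) (row_mx x y).
    by have [_ <-] := grad_comp dg1 (dphi (- mu^-1) _).
  by rewrite gradxE linearZ /= dotvZl -mulrA.
have hI : (@lebesgue_rV R m).-integrable Y (EFin \o (fun y => h (row_mx x y))).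
  by apply: integrable_borel_rV => // y Yy; exact: h_cont.
have dI' : (@lebesgue_rV R m).-integrable Y
    (EFin \o (fun y => h (row_mx x y) * dotv (gradx (g_ mu) x y) u)).
  have := integrableZl mY (- mu) dI; apply: eq_integrable => // y; rewrite inE => Yy.
  rewrite /= gh// -EFinM mulrA mulNr mulrN opprK mulfV ?mul1r//.
  by rewrite gt_eqF.
have hcI : (@lebesgue_rV R m).-integrable Y (EFin \o (fun y => h (row_mx x y) * c)).
  have := integrableZr mY c hI; apply: eq_integrable => // y _.
have -> : (dotv (grad (entropic Y g_ mu) x) u - c) * Z x =
    \int[@lebesgue_rV R m]_(y in Y) (h (row_mx x y) * (dotv (gradx (g_ mu) x y) u - c)).
  under eq_Rintegral do rewrite mulrBr.
  rewrite RintegralB// RintegralZr// mulrBl [c * _]mulrC; congr (_ - _).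
  (* The factor [- mu / Z x] from the logarithm and the factor [- mu^-1] from the weight combine to
     [1 / Z x]. *)
  rewrite entropicE (grad_comp dZ (dln (partition_gt0 Ox))).2 gZ dotvZl.
  have -> : dotv (\row_i \int[@lebesgue_rV R m]_(y in Y) grad h (row_mx x y) 0 (lshift m i)) u =
      - mu^-1 * \int[@lebesgue_rV R m]_(y in Y) (h (row_mx x y) * dotv (gradx (g_ mu) x y) u).
    rewrite -RintegralZl//.
    transitivity (\int[@lebesgue_rV R m]_(y in Y) dotv (lsubmx (grad h (row_mx x y))) u).
      rewrite dE; congr dotv; apply/rowP => i; rewrite !mxE.
      by apply: eq_Rintegral => y _; rewrite [in RHS]mxE.
    by apply: eq_Rintegral => y; rewrite inE => Yy; exact: gh.
  have := partition_gt0 Ox; rewrite -/(Z x); set z := Z x; move=> z0.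
  set I := (X in _ * (_ * X)).
  rewrite -/I; by field; rewrite !gt_eqF.
rewrite -Rintegral_cst//; apply: le_Rintegral => //.
- have := integrableB mY dI' hcI; apply: eq_integrable => // y _.
  by rewrite /= mulrBr EFinB.
- by apply: integrable_borel_rV => // y Yy; exact: cst_continuous.
Qed.

End entropic.

(** * Clarke generalized gradients *)

Definition sublinear (R : realType) (d : nat) (q : 'rV[R]_d -> R) : Prop :=
  (forall u w : 'rV[R]_d, q (u + w) <= q u + q w) /\
  (forall (t : R) (u : 'rV[R]_d), 0 < t -> q (t *: u) = t * q u).

Lemma sublinear0 (R : realType) (d : nat) (q : 'rV[R]_d -> R) : sublinear q -> q 0 = 0.
Proof.
by move=> [_ h]; have := h 2 0 (ltr0Sn R 1); rewrite scaler0 => E; lra.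
Qed.

(* A Zorn-free Hahn-Banach step: q' w = inf_(t >= 0) (q (w + t e) - t q e) is
   linear along the line spanned by e. *)
Lemma sublinear_step (R : realType) (d : nat) (q : 'rV[R]_d -> R) (e : 'rV[R]_d) :
  sublinear q -> exists q', [/\ sublinear q', forall u, q' u <= q u & q' (- e) <= - q e].
Proof.
move=> sq; have q0 := sublinear0 sq; have [sub hom] := sq.
pose S w := [set q (w + t *: e) - t * q e | t in [set t : R | 0 <= t]].
have hom0 t : 0 <= t -> q (t *: e) = t * q e.
  by rewrite le_eqVlt => /predU1P[<-|/hom->//]; rewrite scale0r q0 mul0r.
have lbS w : lbound (S w) (- q (- w)).
  move=> _ [t t0 <-].
  have := sub (w + t *: e) (- w); rewrite addrAC subrr add0r hom0//; lra.
have Sinf w : has_inf (S w).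
  split; last by exists (- q (- w)); exact: lbS.
  by exists (q (w + 0 *: e) - 0 * q e), 0 => //=.
pose q' w := inf (S w).
have q'le w t : 0 <= t -> q' w <= q (w + t *: e) - t * q e.
  by move=> t0; apply: ge_inf; [case: (Sinf w)|exists t].
have q'ge w c : (forall t, 0 <= t -> c <= q (w + t *: e) - t * q e) -> c <= q' w.
  by move=> H; apply: lb_le_inf; [case: (Sinf w)|move=> _ [t t0 <-]; exact: H].
have hom_le t u : 0 < t -> q' (t *: u) <= t * q' u.
  move=> t0; rewrite -ler_pdivrMl//; apply: q'ge => s s0; rewrite ler_pdivrMl//.
  apply: (le_trans (q'le _ (t * s) _)); first by rewrite mulr_ge0// ltW.
  by rewrite -scalerA -scalerDr hom// mulrBr mulrA.
exists q'; split.
- split => [u w|t u t0].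
    rewrite -lerBlDr; apply: (q'ge _ _) => t t0.
    rewrite lerBlDr -lerBlDl; apply: q'ge => s s0; rewrite lerBlDl.
    apply: (le_trans (q'le _ (t + s) (addr_ge0 t0 s0))).
    have := sub (u + t *: e) (w + s *: e); rewrite addrACA -scalerDl; lra.
  apply/eqP; rewrite eq_le hom_le//= -ler_pdivlMl//.
  by apply: le_trans (hom_le _ _ _); rewrite ?invr_gt0// scalerA mulVf ?gt_eqF// scale1r.
- by move=> u; have := q'le u 0 (lexx _); rewrite scale0r addr0 mul0r subr0.
- by have := q'le (- e) 1 ler01; rewrite scale1r addNr q0 mul1r sub0r.
Qed.

(** Linearity already gained along [w] survives later decreases, since [q2 <= q1] gives
    [q2 (- w) <= q1 (- w) <= - q1 w <= - q2 w]. *)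
Lemma sublinear_iter (R : realType) (d : nat) (q : 'rV[R]_d -> R) (s : seq 'rV[R]_d) :
  sublinear q -> exists q', [/\ sublinear q', forall u, q' u <= q u &
    forall e, e \in s -> q' (- e) <= - q' e].
Proof.
move=> sq; elim: s => [|e s [q1 [s1 le1 H1]]]; first by exists q; split.
have [q2 [s2 le2 H2]] := sublinear_step e s1.
exists q2; split => // [u|w]; first exact: le_trans (le2 u) (le1 u).
rewrite inE => /predU1P[->|/H1 H]; first by apply: (le_trans H2); rewrite lerN2.
by apply: (le_trans (le2 _)); apply: (le_trans H); rewrite lerN2.
Qed.

(** Decreasing [p] first along [u0] and then along the basis leaves a [q] that coincides with a
    linear form [dotv xi]. The first decrease forces [q (- u0) <= - p u0], which is the equality at
    [u0]. *)
Lemma sublinear_support (R : realType) (d : nat) (p : 'rV[R]_d -> R) (u0 : 'rV[R]_d) :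
  sublinear p -> exists2 xi, forall u, dotv xi u <= p u & dotv xi u0 = p u0.
Proof.
move=> sp; have [q1 [s1 le1 H1]] := sublinear_step u0 sp.
have [q [sq le2 H2]] := sublinear_iter [seq delta_mx 0 i | i <- enum 'I_d] s1.
have Hd (i : 'I_d) : q (- delta_mx 0 i) <= - q (delta_mx 0 i).
  by apply: H2; apply/mapP; exists i => //; rewrite mem_enum.
have q0 := sublinear0 sq; have [sub hom] := sq.
have homd (i : 'I_d) (a : R) : q (a *: delta_mx 0 i) <= a * q (delta_mx 0 i).
  have [a0|a0|<-] := ltgtP 0 a; first by rewrite hom.
    rewrite -[a in leLHS]opprK scaleNr -scalerN hom ?oppr_gt0//.
    have : - a * q (- delta_mx 0 i) <= - a * (- q (delta_mx 0 i)).
      by rewrite ler_wpM2l// oppr_ge0 ltW.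
    lra.
  by rewrite scale0r q0 mul0r.
pose xi : 'rV[R]_d := \row_i q (delta_mx 0 i).
have qxi u : q u <= dotv xi u.
  rewrite {1}(row_sum_delta u) /dotv.
  apply: (big_ind2 (fun (a : 'rV[R]_d) b => q a <= b)) => [|a b a' b' h h'|i _].
  - by rewrite q0.
  - by apply: (le_trans (sub _ _)); exact: lerD.
  - by rewrite mxE [leRHS]mulrC.
have xiN u : dotv xi (- u) = - dotv xi u by rewrite linearN.
have xile u : dotv xi u <= q u.
  have := qxi (- u); rewrite xiN; have := sub u (- u); rewrite subrr q0; lra.
exists xi => [u|]; first exact: le_trans (xile u) (le_trans (le2 u) (le1 u)).
apply/eqP; rewrite eq_le (le_trans (xile u0) (le_trans (le2 u0) (le1 u0)))/=.
have := xile (- u0); rewrite xiN; have := le2 (- u0); lra.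
Qed.

(** A single tolerance [e] governs the base point, the step and the loss, so lower bounds on the
    Clarke derivative can be checked and exploited without handling the filter limsup. *)
Lemma clarke_ddP (R : realType) (d : nat) (f : 'rV[R]_d -> R) (z u : 'rV[R]_d) (c : R) :
  (c%:E <= clarke_dd f z u)%E <->
  forall e, 0 < e -> exists w s, [/\ `|w - z| < e, 0 < s, s < e &
    c - e <= (f (w + s *: u) - f w) / s].
Proof.
rewrite /clarke_dd /limf_esup; split.
  move=> H e e0; apply: contrapT => /forallNP N.
  pose V := [set p : 'rV[R]_d * R | `|p.1 - z| < e /\ 0 < p.2 < e].
  have FV : filter_prod (nbhs z) 0^'+ V.
    exists ([set w | `|w - z| < e], [set s | 0 < s < e]) => /=.
      split; first by apply/nbhs_ballP; exists e => //= w; rewrite -ball_normE /= distrC.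
      near=> s => /=; apply/andP; split; near: s; [exact: nbhs_right_gt|exact: nbhs_right_lt].
    by move=> [w s] /= [].
  have : (c%:E <= (c - e)%:E)%E.
    apply: (le_trans H); apply: le_trans (ereal_inf_lbound _) _.
      by exists V.
    apply: ge_ereal_sup => _ [[w s] /= [wz /andP[s0 se]] <-]; rewrite lee_fin.
    by rewrite leNgt; apply/negP => H'; apply: (N w); exists s; split => //; exact: ltW.
  rewrite lee_fin; lra.
move=> H; apply: le_ereal_inf_tmp => _ [V [[A B] /= [/nbhs_ballP[e /= e0 eA] B0] AB] <-].
have [e' /= e'0 eB] := B0.
apply/lee_addgt0Pr => k k0.
pose k' := Num.min k (Num.min e e').
have k'0 : 0 < k' by rewrite !lt_min k0 e0.
have [w [s [wz s0 se cq]]] := H _ k'0.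
have [k1 k2 k3] : [/\ k' <= k, k' <= e & k' <= e'].
  by rewrite !ge_min !lexx !orbT.
apply: (@le_trans _ _ (((f (w + s *: u) - f w) / s)%:E + k%:E)%E).
  by rewrite -EFinD lee_fin; lra.
rewrite leeD2r//; apply: ereal_sup_ubound; exists (w, s) => //; apply: AB; split => /=.
  by apply: eA; rewrite -ball_normE /= distrC (lt_le_trans wz).
by apply: eB => //=; rewrite sub0r normrN gtr0_norm// (lt_le_trans se).
Unshelve. all: by end_near. Qed.

Section clarke_lipschitz.
Context (R : realType) (d : nat) (f : 'rV[R]_d -> R) (L : R).
Hypothesis fL : forall x y, `|f x - f y| <= L * `|x - y|.

Let quot_le w u s : 0 < s -> `|(f (w + s *: u) - f w) / s| <= L * `|u|.
Proof.
move=> s0; rewrite normrM normfV (gtr0_norm s0) ler_pdivrMr//.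
apply: (le_trans (fL _ _)); rewrite addrAC subrr add0r normrZ (gtr0_norm s0).
by rewrite mulrA mulrAC.
Qed.

Let dd_bound c z u : (c%:E <= clarke_dd f z u)%E -> c <= L * `|u|.
Proof.
move=> /clarke_ddP H; apply/ler_addgt0Pr => e e0.
have [w [s [_ s0 _ cq]]] := H _ e0.
by have := quot_le w u s0; rewrite ler_norml => /andP[_]; lra.
Qed.

Let dd_ge z u : ((- (L * `|u|))%:E <= clarke_dd f z u)%E.
Proof.
apply/clarke_ddP => e e0; exists z, (e / 2).
split; [by rewrite subrr normr0|by rewrite divr_gt0|lra|].
have := @quot_le z u (e / 2) (divr_gt0 e0 (ltr0Sn R 1)).
by rewrite ler_norml => /andP[+ _]; lra.
Qed.

(** For Lipschitz [f] the derivative is finite by [dd_ge] and [dd_bound], so its real value can be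
    fed to [sublinear_support]. *)
Let p z u := fine (clarke_dd f z u).

Let pE z u : (p z u)%:E = clarke_dd f z u.
Proof.
rewrite fineK// fin_numE; apply/andP; split; apply/eqP => E.
  by have := dd_ge z u; rewrite E.
have : ((L * `|u| + 1)%:E <= clarke_dd f z u)%E by rewrite E leey.
by move=> /dd_bound; lra.
Qed.

Let pP z u c : c <= p z u <-> forall e, 0 < e -> exists w s, [/\ `|w - z| < e, 0 < s, s < e &
    c - e <= (f (w + s *: u) - f w) / s].
Proof. by rewrite -clarke_ddP -pE lee_fin. Qed.

Let p_lt z u c : p z u < c -> exists2 e, 0 < e & forall w s, `|w - z| < e -> 0 < s -> s < e ->
  (f (w + s *: u) - f w) / s < c.
Proof.
rewrite ltNge => /negP N; apply: contrapT => /forall2NP N'.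
apply: N; apply/pP => e e0; have [//|/existsNP[w /existsNP[s]]] := N' e.
move=> /not_implyP[wz /not_implyP[s0 /not_implyP[se /negP]]]; rewrite -leNgt => H.
by exists w, s; split => //; lra.
Qed.

Let p_sublinear z : sublinear (p z).
Proof.
have hom_le (t : R) (u : 'rV[R]_d) : 0 < t -> t * p z u <= p z (t *: u).
  move=> t0; apply/pP => e e0.
  pose e' := Num.min e (Num.min (e * t) (e / t)).
  have e'0 : 0 < e' by rewrite !lt_min e0 mulr_gt0// divr_gt0.
  have [e1 e2 e3] : [/\ e' <= e, e' <= e * t & e' <= e / t].
    by rewrite !ge_min !lexx !orbT.
  have [w [s [wz s0 se H]]] := (pP z u (p z u)).1 (lexx _) _ e'0.
  (* The step [s / t] along [t *: u] reproduces [s *: u]. It has to be below [e], hence [e * t] in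
     [e']; the loss is multiplied by [t], hence [e / t]. *)
  exists w, (s / t); split; first exact: lt_le_trans wz e1.
  - exact: divr_gt0.
  - by rewrite ltr_pdivrMr// (lt_le_trans se).
  - rewrite scalerA divfK ?gt_eqF// invf_div mulrCA.
    apply: (@le_trans _ _ (t * (p z u - e'))).
      by rewrite mulrBr lerB// mulrC -ler_pdivlMr.
    by rewrite ler_wpM2l// ltW.
split => [u w|t u t0].
  apply/ler_addgt0Pr => k k0.
  have k2 : 0 < k / 3 by rewrite divr_gt0.
  have [e1 e10 H1] := @p_lt z u (p z u + k / 3) (ltr_pwDr k2 (lexx _)).
  have [e2 e20 H2] := @p_lt z w (p z w + k / 3) (ltr_pwDr k2 (lexx _)).
  have w0 : 0 < `|w| + 1 by rewrite ltr_wpDl.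
  (* The quotient along [u + w] is split at [x + s *: w], which must stay within [e1] of [z]. Three
     losses of [k / 3] each are allowed. *)
  pose e := Num.min (k / 3) (Num.min e2 (Num.min (e1 / 2) (e1 / 2 / (`|w| + 1)))).
  have e0 : 0 < e by rewrite !lt_min k2 e20 !divr_gt0.
  have [h1 h2 h3 h4] : [/\ e <= k / 3, e <= e2, e <= e1 / 2 & e <= e1 / 2 / (`|w| + 1)].
    by rewrite !ge_min !lexx !orbT.
  have [x [s [xz s0 se H]]] := (pP z (u + w) _).1 (lexx _) _ e0.
  have Hw := H2 x s (lt_le_trans xz h2) s0 (lt_le_trans se h2).
  have Hu : (f (x + s *: w + s *: u) - f (x + s *: w)) / s < p z u + k / 3.
    apply: H1 => //; last lra.
    rewrite addrAC; apply: (le_lt_trans (ler_normD _ _)).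
    rewrite normrZ gtr0_norm// (splitr e1); apply: ltr_leD; first lra.
    apply: (@le_trans _ _ (e * (`|w| + 1))); last by rewrite -ler_pdivlMr.
    by apply: ler_pM => //; [exact: ltW|exact: ltW|rewrite lerDl].
  have : (f (x + s *: (u + w)) - f x) / s = (f (x + s *: w + s *: u) - f (x + s *: w)) / s +
     (f (x + s *: w) - f x) / s.
    by rewrite -mulrDl subrKA scalerDr addrA [x + _ + _]addrAC.
  lra.
apply/eqP; rewrite eq_le hom_le// andbT -ler_pdivrMl//.
have := @hom_le t^-1 (t *: u); rewrite invr_gt0 scalerA mulVf ?gt_eqF// scale1r; exact.
Qed.

(** Hahn-Banach in the direction [u]. It yields nonemptiness of the Clarke gradient and, in case
    (c), subgradients that attain a prescribed directional derivative. *)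
Lemma clarke_support z u : exists2 xi, clarke f z xi & (dotv xi u)%:E = clarke_dd f z u.
Proof.
have [xi H1 H2] := sublinear_support u (p_sublinear z).
by exists xi => [w|]; rewrite -pE ?lee_fin// H2.
Qed.

Lemma clarke_dotv_le z xi u : clarke f z xi -> dotv xi u <= L * `|u|.
Proof. by move=> /(_ u) /dd_bound. Qed.

End clarke_lipschitz.

(** * Limits of the entropic smoothing *)

Lemma row_coord_le_enorm (R : realType) (d : nat) (u : 'rV[R]_d) i : `|u 0 i| <= enorm u.
Proof.
rewrite /enorm -sqrtr_sqr ler_wsqrtr// /dotv (bigD1 i)//= -expr2 lerDl.
by apply: sumr_ge0 => j _; rewrite -expr2 sqr_ge0.
Qed.

Lemma dist_set_lt (R : realType) (d : nat) (z : 'rV[R]_d) (A : set 'rV[R]_d) (e : R) :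
  A !=set0 -> dist_set z A < e -> exists2 a, A a & enorm (a - z) < e.
Proof.
move=> [a0 Aa0] H.
have [|_ [a Aa <-] ae] := inf_lt _ H; last by exists a.
by exists (enorm (a0 - z)), a0.
Qed.

Lemma norm_row_mx0 (R : realType) (n m : nat) (u : 'rV[R]_n) :
  `|row_mx u (0 : 'rV[R]_m)| <= `|u|.
Proof.
rewrite [leLHS]/Num.norm /= mx_normrE; apply: bigmax_le => // -[i j] _ /=.
rewrite mxE (ord1 i); case: splitP => k _; first exact: row_coord_le_norm.
by rewrite mxE normr0.
Qed.

Lemma norm_row_mxr (R : realType) (n m : nat) (u : 'rV[R]_m) :
  `|row_mx (0 : 'rV[R]_n) u| <= `|u|.
Proof.
rewrite [leLHS]/Num.norm /= mx_normrE; apply: bigmax_le => // -[i j] _ /=.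
rewrite mxE (ord1 i); case: splitP => k _; last exact: row_coord_le_norm.
by rewrite mxE normr0.
Qed.

Lemma lipschitz_const (R : realType) (V : normedModType R) (f : V -> R) :
  lipschitz f -> exists2 L, 0 < L & forall x y, `|f x - f y| <= L * `|x - y|.
Proof.
move=> [M [_ H]]; exists (`|M| + 1); first by rewrite ltr_wpDl.
move=> x y; apply: (H (`|M| + 1) _ (x, y)) => //.
by rewrite (le_lt_trans (ler_norm _))// ltrDl.
Qed.

Lemma uniform_cvg_near (R : realType) (U : choiceType) (I : Type) (A : set U) (F : set_system I)
    {FF : Filter F} (f_ : I -> U -> R) (f : U -> R) (e : R) :
  {uniform A, f_ @ F --> f} -> 0 < e -> \forall i \near F, forall x, A x -> `|f x - f_ i x| < e.
Proof.
move=> cv e0; apply: (cv [set h | forall x, A x -> `|f x - h x| < e]).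
apply/uniform_nbhs; exists [set p | `|p.1 - p.2| < e]; split => //.
by exists e => //= p; rewrite -ball_normE.
Qed.

Lemma near_fst (I J : Type) (F : set_system I) (G : set_system J) (P : set I) :
  Filter G -> F P -> \forall p \near filter_prod F G, P p.1.
Proof. by move=> FG FP; exists (P, setT) => /= [|p []//]; split => //; exact: filterT. Qed.

Lemma near_snd (I J : Type) (F : set_system I) (G : set_system J) (P : set J) :
  Filter F -> G P -> \forall p \near filter_prod F G, P p.2.
Proof. by move=> FF GP; exists (setT, P) => /= [|p []//]; split => //; exact: filterT. Qed.

Lemma near_snd_gt0 (R : realType) (I : Type) (F : set_system I) :
  Filter F -> \forall p \near filter_prod F (0 : R)^'+, 0 < p.2.
Proof. by move=> FF; apply: (near_snd (P := [set t | 0 < t])); exact: nbhs_right_gt. Qed.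

Lemma near_snd_lt (R : realType) (I : Type) (F : set_system I) (e : R) :
  Filter F -> 0 < e -> \forall p \near filter_prod F (0 : R)^'+, p.2 < e.
Proof. by move=> FF e0; apply: (near_snd (P := [set t | t < e])); exact: nbhs_right_lt. Qed.

(** * Attainment and Lipschitz continuity of the value function *)

Section min_value.
Context (R : realType) (n m : nat).
Variables (Y : set 'rV[R]_m) (g : 'rV[R]_(n + m) -> R) (L : R).
Hypotheses (cY : compact Y) (Yn0 : Y !=set0) (L0 : 0 < L)
  (gL : forall x y, `|g x - g y| <= L * `|x - y|).

Lemma lipschitz_xl x x' y : `|g (row_mx x y) - g (row_mx x' y)| <= L * `|x - x'|.
Proof.
apply: (le_trans (gL _ _)); rewrite opp_row_mx add_row_mx subrr.
by rewrite ler_pM2l// norm_row_mx0.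
Qed.

Lemma lipschitz_xr x y y' : `|g (row_mx x y) - g (row_mx x y')| <= L * `|y - y'|.
Proof.
apply: (le_trans (gL _ _)); rewrite opp_row_mx add_row_mx subrr.
by rewrite ler_pM2l// norm_row_mxr.
Qed.

Lemma lipschitz_continuous (V : normedModType R) (f : V -> R) :
  (forall x y, `|f x - f y| <= L * `|x - y|) -> continuous f.
Proof.
move=> fL x; apply/(@cvgrPdist_le _ _ _ (nbhs x) (nbhs_filter x)) => e e0.
apply/nbhs_ballP; exists (e / L); first exact: divr_gt0.
move=> y; rewrite -ball_normE /= => xy; apply: (le_trans (fL _ _)).
by rewrite -ler_pdivlMl// mulrC ltW.
Qed.

Lemma min_value_attained x :
  exists2 y, argmin_set Y g x y & min_value Y g x = g (row_mx x y).
Proof.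
have cg : continuous (fun y => g (row_mx x y)).
  exact/lipschitz_continuous/lipschitz_xr.
have [y Yy Hy] := compact_EVT_min Yn0 cY (continuous_subspaceT cg).
rewrite inE in Yy.
exists y; first by split => // y' Yy'; apply: Hy; rewrite inE.
apply/eqP; rewrite eq_le; apply/andP; split.
  apply: ge_inf; last by exists y.
  by exists (g (row_mx x y)) => _ [y' Yy' <-]; apply: Hy; rewrite inE.
by apply: lb_le_inf; [exists (g (row_mx x y)), y|move=> _ [y' Yy' <-]; apply: Hy; rewrite inE].
Qed.

Lemma min_value_le x y : Y y -> min_value Y g x <= g (row_mx x y).
Proof. by move=> Yy; have [y0 [_ H] ->] := min_value_attained x; exact: H. Qed.

Lemma argmin_value x y : argmin_set Y g x y -> min_value Y g x = g (row_mx x y).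
Proof.
move=> [Yy H]; have [y0 [Yy0 H0] ->] := min_value_attained x.
by apply/eqP; rewrite eq_le H// H0.
Qed.

Lemma min_value_lipschitz x x' : `|min_value Y g x - min_value Y g x'| <= L * `|x - x'|.
Proof.
suff H a b : min_value Y g a - min_value Y g b <= L * `|a - b|.
  rewrite ler_norml H andbT lerNl opprB distrC; exact: H.
have [y [Yy _] ->] := min_value_attained b.
apply: (@le_trans _ _ (g (row_mx a y) - g (row_mx b y))).
  by rewrite lerB// min_value_le.
by apply: (le_trans (ler_norm _)); exact: lipschitz_xl.
Qed.

Lemma min_value_continuous : continuous (min_value Y g).
Proof. exact/lipschitz_continuous/min_value_lipschitz. Qed.

End min_value.

Lemma filter_nbhs_pos (R : realType) (n : nat) (z : 'rV[R]_n) :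
  Filter (filter_prod (nbhs z) (0 : R)^'+).
Proof. exact: filter_prod_filter. Qed.

(** * Laplace asymptotics of the partition function and limits of gradients *)

Section entropic_limits.
Context (R : realType) (n m : nat).
Variables (OX : set 'rV[R]_n) (OY Y : set 'rV[R]_m) (g : 'rV[R]_(n + m) -> R)
  (g_ : R -> 'rV[R]_(n + m) -> R) (L : R).
Hypotheses (oOX : open OX) (oOY : open OY) (YOY : Y `<=` OY) (cY : compact Y)
  (cvY : convex_set Y) (Y0 : (0 < lebesgue_rV Y)%E)
  (L0 : 0 < L) (gL : forall x y, `|g x - g y| <= L * `|x - y|)
  (dg : forall mu, 0 < mu -> cont_differentiable (rVprod OX OY) (g_ mu))
  (gu : forall Omega' : set 'rV[R]_n, open Omega' -> closure Omega' `<=` OX ->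
    {uniform rVprod (closure Omega') Y, g_ @ 0^'+ --> g}).

Lemma lebesgue_rV_gt0_nonempty : Y !=set0.
Proof. by apply/set0P; apply: contraTneq Y0 => ->; rewrite measure0 ltxx. Qed.

(** Uniform convergence is used on a ball whose closure lies in [OX], at a cost of [e / 2]; the
    Lipschitz bound then moves the first argument from [p.1] to [z] at the same cost. *)
Lemma near_approx z (e : R) : OX z -> 0 < e ->
  \forall p \near filter_prod (nbhs z) 0^'+, [/\ OX p.1, 0 < p.2 &
    forall y, Y y -> `|g_ p.2 (row_mx p.1 y) - g (row_mx z y)| < e].
Proof.
move=> Oz e0; have /nbhs_closedballP[r0 rO] : nbhs z OX by exact: open_nbhs_nbhs.
pose r : R := r0%:num; have rp : 0 < r by rewrite /r gt0.
have clO : closure (ball z r) `<=` OX.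
  by have := rO; rewrite closure_ballE.
have e2 : 0 < e / 2 by rewrite divr_gt0.
have U : \forall mu \near 0^'+, forall x, rVprod (closure (ball z r)) Y x ->
    `|g x - g_ mu x| < e / 2.
  exact: uniform_cvg_near (gu (ball_open z r) clO) e2.
have FV : filter_prod (nbhs z) (0 : R)^'+ (fun p => (ball z r `&` ball z (e / 2 / L)) p.1 /\
    ([set mu | 0 < mu] `&` [set mu | forall x, rVprod (closure (ball z r)) Y x ->
      `|g x - g_ mu x| < e / 2]) p.2).
  apply: filterI.
    by apply: near_fst; apply: filterI; apply: nbhsx_ballx => //; rewrite !divr_gt0.
  by apply: near_snd; apply: filterI => //; exact: nbhs_right_gt.
apply: (@filterS _ _ (filter_nbhs_pos z)) FV => p [[pz zp] [p0 Up]].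
split => //; first by apply: clO; exact: subset_closure.
move=> y Yy.
rewrite -(subrKA (g (row_mx p.1 y))) (splitr e); apply: (le_lt_trans (ler_normD _ _)).
apply: ltr_leD.
  rewrite distrC; apply: Up; rewrite /rVprod /= row_mxKl row_mxKr; split => //.
  exact: subset_closure.
apply: (le_trans (lipschitz_xl L0 gL _ _ _)).
rewrite -ler_pdivlMl// mulrC; move: zp; rewrite -ball_normE /= distrC.
exact: ltW.
Qed.

Let gibbs mu z := expR (- mu^-1 * g_ mu z).
Let Z mu x := \int[@lebesgue_rV R m]_(y in Y) gibbs mu (row_mx x y).

Let in_prod x y : OX x -> Y y -> rVprod OX OY (row_mx x y).
Proof. by move=> Ox Yy; rewrite /rVprod/= row_mxKl row_mxKr; split => //; exact: YOY. Qed.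

Let gibbs_cont mu x y : 0 < mu -> OX x -> Y y -> {for y, continuous (fun y => gibbs mu (row_mx x y))}.
Proof.
move=> mu0 Ox Yy.
have cgy : {for y, continuous (fun y => g_ mu (row_mx x y))}.
  apply: (@continuous_comp _ _ _ (fun y => row_mx x y) (g_ mu)).
    exact: continuous_row_mxr.
  by have [/differentiable_continuous + _] := dg mu0 (in_prod Ox Yy).
apply: (@continuous_comp _ _ _ (fun y => - mu^-1 * g_ mu (row_mx x y)) expR).
  apply: (@continuous_comp _ _ _ (fun y => g_ mu (row_mx x y)) ( *%R (- mu^-1))) => //.
  exact: mulrl_continuous.
exact: continuous_expR.
Qed.

(** Only the sublevel set [U] of [g(z, .)] at height [min + e / 2] is kept. It meets [Y] in positive
    volume [k], and there [g_ mu] is at most [min + e] for points near [z] and small [mu]. *)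
Lemma near_partition_ge z (e : R) : OX z -> 0 < e -> exists2 k, 0 < k &
  \forall p \near filter_prod (nbhs z) 0^'+,
    k * expR (- p.2^-1 * (min_value Y g z + e)) <= Z p.2 p.1.
Proof.
move=> Oz e0; have Yn0 := lebesgue_rV_gt0_nonempty.
have [y0 [Yy0 _] vE] := min_value_attained cY Yn0 L0 gL z.
have e2 : 0 < e / 2 by rewrite divr_gt0.
pose U : set 'rV[R]_m := [set y | g (row_mx z y) < min_value Y g z + e / 2].
have oU : open U.
  have cg : continuous (fun y => g (row_mx z y)).
    by apply: (@lipschitz_continuous _ L) => //; exact: lipschitz_xr.
  by apply: (@open_comp _ _ (fun y => g (row_mx z y)) [set t | t < min_value Y g z + e / 2]) => //;
    exact: open_lt.
have Uy0 : U y0 by rewrite /U /= -vE ltrDl.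
have [k k0 Hk] := Rintegral_borel_rV_gt cY cvY Y0 oU Yy0 Uy0.
exists k => //; apply: (@filterS _ _ (filter_nbhs_pos z)) (near_approx Oz e2) => p [Op p0 Hp].
apply: Hk => [y Yy|y Yy|y Yy Uy]; [exact: gibbs_cont|exact: expR_ge0|].
rewrite /gibbs ler_expR !mulNr lerN2 ler_pM2l ?invr_gt0//.
have := Hp y Yy; rewrite ltr_norml => /andP[_ H]; have : g (row_mx z y) < min_value Y g z + e / 2 by [].
lra.
Qed.

Lemma near_partition_le z (e : R) : OX z -> 0 < e ->
  \forall p \near filter_prod (nbhs z) 0^'+,
    Z p.2 p.1 <= expR (- p.2^-1 * (min_value Y g z - e)) * fine (@lebesgue_rV R m Y).
Proof.
move=> Oz e0; have Yn0 := lebesgue_rV_gt0_nonempty.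
have mY := measurable_borel_rV_compact cY.
apply: (@filterS _ _ (filter_nbhs_pos z)) (near_approx Oz e0) => p [Op p0 Hp].
rewrite -Rintegral_cst//; apply: le_Rintegral => //.
- by apply: integrable_borel_rV => // y Yy; exact: gibbs_cont.
- by apply: integrable_borel_rV => // y Yy; exact: cst_continuous.
- move=> y Yy; rewrite /gibbs ler_expR !mulNr lerN2 ler_pM2l ?invr_gt0//.
  have := Hp y Yy; rewrite ltr_norml => /andP[H _].
  have := min_value_le cY Yn0 L0 gL z Yy; lra.
Qed.

Let near_small (c e : R) (z : 'rV[R]_n) : 0 < e ->
  \forall p \near filter_prod (nbhs z) 0^'+, 0 < p.2 /\ `|p.2 * c| < e.
Proof.
move=> e0; have c0 : 0 < `|c| + 1 by rewrite ltr_wpDl.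
have ec0 : 0 < e / (`|c| + 1) by rewrite divr_gt0.
apply: (@filterS2 _ _ (filter_nbhs_pos z)) (@near_snd_gt0 R _ _ (nbhs_filter z))
  (near_snd_lt (nbhs_filter z) ec0).
move=> p p0; rewrite ltr_pdivlMr// => H; split => //.
rewrite normrM gtr0_norm//; apply: le_lt_trans H.
by rewrite ler_pM2l// lerDl.
Qed.

(** Logarithms of the two bounds on [Z] leave the errors [mu * ln k] and [mu] times the logarithm of
    the volume of [Y]; both vanish because [k] is independent of [mu]. *)
Lemma entropic_cvg z : OX z ->
  entropic Y g_ p.2 p.1 @[p --> filter_prod (nbhs z) 0^'+] --> min_value Y g z.
Proof.
move=> Oz; apply/cvgrPdist_le => e e0.
have e2 : 0 < e / 2 by rewrite divr_gt0.
have [k k0 Hk] := near_partition_ge Oz e2.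
have vol0 : 0 < fine (@lebesgue_rV R m Y).
  by rewrite fine_gt0// Y0 lebesgue_rV_compact_lty.
have FF := filter_nbhs_pos z.
have H1 := @filterI _ _ FF _ _ Hk (near_partition_le Oz e2).
have H2 := @filterI _ _ FF _ _ (near_small (ln k) z e2)
  (near_small (ln (fine (@lebesgue_rV R m Y))) z e2).
apply: (@filterS _ _ FF _ _ _ (@filterI _ _ FF _ _ H1 H2)).
move=> p [[Zl Zu] [[p0 kl] [_ vl]]].
have Z0 : 0 < Z p.2 p.1 by apply: lt_le_trans Zl; rewrite mulr_gt0// expR_gt0.
have lZl : ln k + - p.2^-1 * (min_value Y g z + e / 2) <= ln (Z p.2 p.1).
  rewrite -[X in _ + X]expRK -lnM ?posrE ?expR_gt0//.
  by rewrite ler_ln ?posrE// mulr_gt0// expR_gt0.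
have lZu : ln (Z p.2 p.1) <= - p.2^-1 * (min_value Y g z - e / 2) + ln (fine (@lebesgue_rV R m Y)).
  rewrite -[X in X + _]expRK -lnM ?posrE ?expR_gt0//.
  by rewrite ler_ln ?posrE// mulr_gt0// expR_gt0.
have mulV a : p.2 * (- p.2^-1 * a) = - a by rewrite mulNr mulrN mulrA mulfV ?mul1r// gt_eqF.
have {}lZl : p.2 * ln k - (min_value Y g z + e / 2) <= p.2 * ln (Z p.2 p.1).
  by rewrite -mulV -mulrDr ler_pM2l.
have {}lZu : p.2 * ln (Z p.2 p.1) <= - (min_value Y g z - e / 2) + p.2 * ln (fine (@lebesgue_rV R m Y)).
  by rewrite -mulV -mulrDr ler_pM2l.
rewrite /entropic -/(Z p.2 p.1) mulNr opprK.
move: kl vl; rewrite !ltr_norml ler_norml => /andP[? ?] /andP[? ?].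
apply/andP; split; lra.
Qed.

Variable xbar : 'rV[R]_n.
Hypotheses (Oxbar : OX xbar)
  (gradu : {uniform Y,
    (fun (p : 'rV[R]_n * R) (y : 'rV[R]_m) =>
       dist_set (gradx (g_ p.2) p.1 y) (clarkex g p.1 y))
      @ filter_prod (nbhs xbar) 0^'+ --> (fun _ : 'rV[R]_m => 0 : R)}).

Let v := min_value Y g.

Lemma near_gradx (e : R) : 0 < e -> \forall p \near filter_prod (nbhs xbar) 0^'+,
  forall y, Y y -> exists2 eta, clarkex g p.1 y eta &
    forall u, `|dotv (gradx (g_ p.2) p.1 y) u - dotv eta u| <= e * `|u|.
Proof.
move=> e0; have n0 : 0 < (n%:R + 1 : R) by rewrite ltr_wpDl.
have en0 : 0 < e / (n%:R + 1) by rewrite divr_gt0.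
apply: (@filterS _ _ (filter_nbhs_pos xbar)) (uniform_cvg_near gradu en0) => p Hp y Yy.
have := Hp y Yy; rewrite sub0r normrN => /(le_lt_trans (ler_norm _)) H.
(* [dist_set] to the empty set is 0 by default, so a small distance produces a nearby subgradient
   only once nonemptiness is known. *)
have ne : clarkex g p.1 y !=set0.
  have [|xi Hxi _] := @clarke_support R n (fun x => g (row_mx x y)) L _ p.1 0.
    by move=> a b; exact: lipschitz_xl.
  by exists xi.
have [eta Heta He] := dist_set_lt ne H.
exists eta => // u; rewrite -dotvBl.
apply: (@le_trans _ _ (n%:R * (e / (n%:R + 1)) * `|u|)).
  apply: normr_dotv_le => i; rewrite -normrN -opprB.
  have := row_coord_le_enorm (eta - gradx (g_ p.2) p.1 y) i.
  by rewrite !mxE => /le_trans; rewrite opprK distrC; apply; exact: ltW.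
rewrite ler_wpM2r// mulrCA; apply: ler_piMr; first exact: ltW.
by rewrite ler_pdivrMr// mul1r lerDl.
Qed.

Lemma clarkex_le x y eta u : clarkex g x y eta -> `|dotv eta u| <= L * `|u|.
Proof.
move=> H; rewrite ler_norml.
have gx a b : `|g (row_mx a y) - g (row_mx b y)| <= L * `|a - b| by exact: lipschitz_xl.
rewrite (clarke_dotv_le gx u H) andbT lerNl.
have := clarke_dotv_le gx (- u) H; rewrite normrN.
by rewrite [dotv _ _]linearN.
Qed.

Lemma near_gradx_bound u : \forall p \near filter_prod (nbhs xbar) 0^'+,
  forall y, Y y -> `|dotv (gradx (g_ p.2) p.1 y) u| <= (L + 1) * `|u|.
Proof.
apply: (@filterS _ _ (filter_nbhs_pos xbar)) (near_gradx ltr01) => p H y Yy; have [eta He H1] := H y Yy.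
rewrite -[dotv (gradx _ _ _) _](subrK (dotv eta u)) mulrDl [leRHS]addrC.
apply: (le_trans (ler_normD _ _)); apply: lerD; [exact: H1|exact: clarkex_le He].
Qed.

(** A Gibbs mean obeys every bound valid at all [y] in [Y]: [grad_entropic_le] with [B = 0] gives
    one side, and the direction [- u] gives the other. *)
Lemma near_grad_entropic_bound u : \forall p \near filter_prod (nbhs xbar) 0^'+,
  `|dotv (grad (entropic Y g_ p.2) p.1) u| <= (L + 1) * `|u|.
Proof.
have H : forall w, \forall p \near filter_prod (nbhs xbar) 0^'+,
    dotv (grad (entropic Y g_ p.2) p.1) w <= (L + 1) * `|w|.
  move=> w; apply: (@filterS2 _ _ (filter_nbhs_pos xbar)) (near_gradx_bound w) (near_approx Oxbar ltr01).
  move=> p Hw [Op p0 _].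
  have Z0 := partition_gt0 oOX oOY YOY cY cvY Y0 (dg p0) Op.
  have := grad_entropic_le oOX oOY YOY cY cvY Y0 p0 (dg p0) (u := w) (c := (L + 1) * `|w|) (B := 0) Op.
  rewrite mul0r pmulr_lle0// subr_le0; apply => y Yy.
  rewrite pmulr_rle0 ?expR_gt0// subr_le0.
  exact: le_trans (ler_norm _) (Hw y Yy).
apply: (@filterS2 _ _ (filter_nbhs_pos xbar)) (H u) (H (- u)) => p H1 H2.
rewrite ler_norml H1 andbT lerNl -[leRHS]/((L + 1) * `|u|).
by move: H2; rewrite [dotv _ (- u)]linearN normrN.
Qed.

(** If no near-minimizer reached the mean minus [e], then only points with [g > v xbar + a] could
    compensate, and their Gibbs weight is too small against the lower bound of [Z]. *)
Lemma near_concentration u (a e : R) : 0 < a -> 0 < e ->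
  \forall p \near filter_prod (nbhs xbar) 0^'+,
    exists y, [/\ Y y, g (row_mx xbar y) <= v xbar + a &
      dotv (grad (entropic Y g_ p.2) p.1) u - e <= dotv (gradx (g_ p.2) p.1 y) u].
Proof.
move=> a0 e0; pose FF := filter_nbhs_pos xbar.
have a8 : 0 < a / 8 by rewrite divr_gt0.
have [k k0 Hk] := near_partition_ge Oxbar a8.
pose V := fine (@lebesgue_rV R m Y).
have V0 : 0 <= V by rewrite fine_ge0.
(* [M] bounds [gradx] in direction [u] minus [A - e]; the pointwise gradient and the mean contribute
   at most [(L + 1) * |u|] each. *)
pose M := 2 * ((L + 1) * `|u|) + e.
have M0 : 0 < M by rewrite ltr_wpDl// mulr_ge0// mulr_ge0// ltW// addr_gt0.
(* for mu below this threshold, the Gibbs weight of {g > v + a} is negligible *)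
pose C := a / 2 / (M * V / (e * k) + 1).
have C10 : 0 < M * V / (e * k) + 1.
  by rewrite ltr_wpDl// divr_ge0// ?mulr_ge0// ltW// mulr_gt0.
have C0 : 0 < C by rewrite !divr_gt0.
have H1 := @filterI _ _ FF _ _ (near_approx Oxbar a8) Hk.
have H2 := @filterI _ _ FF _ _ (near_gradx_bound u) (near_grad_entropic_bound u).
have H3 := @near_snd_lt R _ _ C (nbhs_filter xbar) C0.
apply: (@filterS3 _ _ FF _ _ _ _ _ H1 H2 H3).
move=> [x mu] /= [[Ox mu0 Hg] HZ] [HD HA] muC.
set A := dotv (grad _ _) u; rewrite -/A in HA.
apply: contrapT => /forallNP N.
(* Where [g] exceeds [v xbar + a], [g_ mu] exceeds [v xbar + a - a / 8]; elsewhere the integrand is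
   nonpositive by the contradiction hypothesis [N]. So [B] works on all of [Y]. *)
pose B := M * expR (- mu^-1 * (v xbar + a - a / 8)).
have B0 : 0 <= B by rewrite mulr_ge0// ?expR_ge0// ltW.
have HB y : Y y -> expR (- mu^-1 * g_ mu (row_mx x y)) *
    (dotv (gradx (g_ mu) x y) u - (A - e)) <= B.
  move=> Yy; have [near_min|far] := leP (g (row_mx xbar y)) (v xbar + a).
    apply: le_trans B0; rewrite pmulr_rle0 ?expR_gt0// subr_le0 leNgt.
    by apply/negP => H; apply: (N y); split => //; exact: ltW.
  have DM : dotv (gradx (g_ mu) x y) u - (A - e) <= M.
    have := HD y Yy; rewrite ler_norml => /andP[_ h1].
    by move: HA; rewrite ler_norml => /andP[h2 _]; rewrite /M; lra.
  rewrite mulrC /B; apply: (@le_trans _ _ (M * expR (- mu^-1 * g_ mu (row_mx x y)))).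
    by rewrite ler_wpM2r// expR_ge0.
  rewrite ler_wpM2l ?(ltW M0)// ler_expR !mulNr lerN2 ler_pM2l ?invr_gt0//.
  by have := Hg y Yy; rewrite ltr_norml => /andP[h1 _]; lra.
have := grad_entropic_le oOX oOY YOY cY cvY Y0 mu0 (dg mu0) Ox HB.
rewrite -/A opprB addrCA subrr addr0 => H.
have {}H : e * (k * expR (- mu^-1 * (v xbar + a / 8))) <= B * V.
  by apply: le_trans H; rewrite ler_pM2l.
(* The lower bound of [Z] has height [v xbar + a / 8]; the gap to the height in [B] is
   [a - a / 8 - a / 8 = a - a / 4]. *)
have E1 : expR (- mu^-1 * (v xbar + a / 8)) =
    expR (- mu^-1 * (v xbar + a - a / 8)) * expR (mu^-1 * (a - a / 4)).
  by rewrite -expRD; congr expR; lra.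
have : e * k * expR (mu^-1 * (a - a / 4)) <= M * V.
  rewrite -(ler_pM2l (expR_gt0 (- mu^-1 * (v xbar + a - a / 8)))).
  move: H; rewrite E1 /B => H.
  lra.
(* The estimate [1 + t <= expR t] suffices, since [mu < C] makes [M * V / (e * k)] smaller than
   [a / 2 / mu], which is below the exponent [(a - a / 4) / mu]. *)
apply/negP; rewrite -ltNge [ltRHS]mulrC -ltr_pdivrMr ?mulr_gt0//.
apply: (@lt_le_trans _ _ (mu^-1 * (a - a / 4))); last first.
  by have := expR_ge1Dx (mu^-1 * (a - a / 4)); set t := mu^-1 * _ => ?; lra.
rewrite [ltRHS]mulrC ltr_pdivlMr//.
move: muC; rewrite /C ltr_pdivlMr// mulrC => h.
have : (M * V / (e * k)) * mu <= (M * V / (e * k) + 1) * mu.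
  by rewrite ler_wpM2r ?(ltW mu0)// lerDl.
lra.
Qed.

Lemma cvg_filter_prod_pos (zs : nat -> 'rV[R]_n) (mus : nat -> R) (P : set ('rV[R]_n * R)) :
  zs @ \oo --> xbar -> (forall k, 0 < mus k) -> mus @ \oo --> (0 : R) ->
  filter_prod (nbhs xbar) 0^'+ P -> \forall k \near \oo, P (zs k, mus k).
Proof.
move=> zsx mus0 musc [[A B] /= [nA nB] AB].
have H1 : \forall k \near \oo, A (zs k) by exact: zsx.
have nB' : nbhs (0 : R) [set x | 0 < x -> B x] := nB.
have H2 : \forall k \near \oo, 0 < mus k -> B (mus k) by exact: musc nB'.
by apply: filterS2 H1 H2 => k Ak Bk; apply: (AB (zs k, mus k)); split => //; exact: Bk.
Qed.

Lemma limsup_quotient xi u d : grad_limsup (entropic Y g_) xbar xi -> 0 < d ->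
  exists x y s, [/\ `|x - xbar| < d, Y y, g (row_mx xbar y) <= v xbar + d, 0 < s < d &
    dotv xi u - d <= (g (row_mx (x + s *: u) y) - g (row_mx x y)) / s].
Proof.
move=> [zs [mus [zsx mus0 musc gradc]]] d0.
(* Four losses of [d / 4] add up to [d]: from [xi] to a gradient, from that mean to one point [y],
   from [gradx] to a Clarke subgradient [eta], and from [eta] to a difference quotient. *)
have d4 : 0 < d / 4 by rewrite divr_gt0.
have u1 : 0 < `|u| + 1 by rewrite ltr_wpDl.
have du : 0 < d / 4 / (`|u| + 1) by rewrite divr_gt0.
have FF := filter_nbhs_pos xbar.
have N1 := cvg_filter_prod_pos zsx mus0 musc
  (near_concentration u d0 d4).
have N2 := cvg_filter_prod_pos zsx mus0 musc (near_gradx du).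
have N3 : \forall k \near \oo, ball xbar (d / 2) (zs k).
  by apply: zsx; apply: nbhsx_ballx; rewrite divr_gt0.
have N4 : \forall k \near \oo, `|dotv xi u - dotv (grad (entropic Y g_ (mus k)) (zs k)) u| < d / 4.
  have cd : dotv (grad (entropic Y g_ (mus k)) (zs k)) u @[k --> \oo] --> dotv xi u.
    rewrite dotvC; under eq_fun do rewrite dotvC.
    exact: cvg_comp gradc (@dotv_continuous R n u xi).
  exact: (@cvgr_dist_lt _ _ _ \oo _ _ _ cd).
have [k [[[y [Yy yv Hy]] Hk2] [Hk3 Hk4]]] := filter_ex (filterI (filterI N1 N2) (filterI N3 N4)).
have [eta Heta /(_ u) Hetau] := Hk2 y Yy.
have [x [s [xz s0 sd Hq]]] := (clarke_ddP _ _ _ _).1 (Heta u) _ d4.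
exists x, y, s; split => //.
- rewrite -(subrKA (zs k)); apply: (le_lt_trans (ler_normD _ _)).
  move: Hk3; rewrite -ball_normE /= distrC => Hk3; lra.
- by rewrite s0/=; lra.
- have : `|dotv (gradx (g_ (mus k)) (zs k) y) u - dotv eta u| <= d / 4.
    apply: (le_trans Hetau); rewrite mulrAC ler_pdivrMr// ler_pM2l//.
    by rewrite lerDl.
  rewrite ler_norml => /andP[_ h1]; move: Hk4; rewrite ltr_norml => /andP[_ h2].
  move: Hq Hy => /=; lra.
Qed.

(** The point [y] of [limsup_quotient] depends on [d], but [Q d y] weakens as [d] grows. If no
    [ybar] in [Y] were approached by such points for every [d], compactness would exclude [Q d] on
    all of [Y] for some small [d]. *)
Lemma limsup_argmin xi u : grad_limsup (entropic Y g_) xbar xi ->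
  exists2 ybar, argmin_set Y g xbar ybar & forall d, 0 < d ->
  exists x y s, [/\ `|x - xbar| < d, `|y - ybar| < d, Y y, 0 < s < d &
    dotv xi u - d <= (g (row_mx (x + s *: u) y) - g (row_mx x y)) / s].
Proof.
move=> Hxi.
pose Q d y := exists x s, [/\ `|x - xbar| < d, g (row_mx xbar y) <= v xbar + d, 0 < s < d &
    dotv xi u - d <= (g (row_mx (x + s *: u) y) - g (row_mx x y)) / s].
have QM d d' y : d <= d' -> Q d y -> Q d' y.
  move=> dd' [x [s [h1 h2 /andP[h3 h4] h5]]]; exists x, s; split.
  - exact: lt_le_trans h1 dd'.
  - by apply: (le_trans h2); rewrite lerD2l.
  - by rewrite h3 (lt_le_trans h4).
  - by apply: le_trans h5; rewrite lerB.
have [ybar Yybar Hy] : exists2 ybar, Y ybar & forall d, 0 < d ->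
    exists2 y, Y y & `|y - ybar| < d /\ Q d y.
  apply: contrapT => N.
  have cov : forall y, Y y -> \forall y' \near y & d \near (0 : R)^'+, Y y' -> ~ Q d y'.
    move=> y Yy; have [d0 d00 Hd] : exists2 d, 0 < d & forall y', Y y' -> `|y' - y| < d -> ~ Q d y'.
      apply: contrapT => N'; apply: N; exists y => // d d0.
      apply: contrapT => N''; apply: N'; exists d => // y' Yy' yy' Qy'.
      by apply: N''; exists y'.
    exists (ball y d0, [set d | d < d0]) => /=.
      by split; [exact: nbhsx_ballx|exact: nbhs_right_lt].
    move=> [y' d] [/= yy' dd0] Yy' Qd; apply: (Hd y' Yy'); last exact: QM (ltW dd0) Qd.
    by move: yy'; rewrite -ball_normE /= distrC.
  have far : \forall d \near (0 : R)^'+, forall y, Y y -> ~ Q d y.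
    exact: ((near_covering_withinP Y).2 ((compact_near_coveringP Y).1 cY) R (0 : R)^'+
      (fun d y => ~ Q d y) _ cov).
  have pos : \forall d \near (0 : R)^'+, 0 < d by exact: nbhs_right_gt.
  have [d [d0 H]] := filter_ex (filterI pos far).
  have [x [y [s [h1 Yy h2 h3 h4]]]] := limsup_quotient u Hxi d0.
  by apply: (H y Yy); exists x, s.
exists ybar.
  split => // y Yy; apply: (@le_trans _ _ (v xbar)).
    apply/ler_addgt0Pr => e e0.
    have L1 : 0 < L + 1 by rewrite addr_gt0.
    (* With tolerance [d], [g (row_mx xbar ybar) <= v xbar + d + L * d]; this choice of [d] makes
       the error equal to [e]. *)
    have [y' Yy' [yy' [x [s [_ h _ _]]]]] := Hy (e / (L + 1)) (divr_gt0 e0 L1).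
    have := lipschitz_xr L0 gL xbar ybar y'; rewrite distrC => h'.
    have h'' : L * `|y' - ybar| <= L * (e / (L + 1)) by rewrite ler_pM2l// ltW.
    have : L * (e / (L + 1)) + e / (L + 1) = e by field; rewrite gt_eqF.
    by move: h'; rewrite distrC ler_norml [`|ybar - y'|]distrC => /andP[_ h']; lra.
  exact: min_value_le cY lebesgue_rV_gt0_nonempty L0 gL _ _ Yy.
move=> d /Hy[y Yy [yy' [x [s [h1 h2 h3 h4]]]]]; exists x, y, s; split => //.
Qed.

End entropic_limits.

(** * The three regularity conditions *)

Lemma convex_functionP (R : realType) (d : nat) (A : set 'rV[R]_d) (f : 'rV[R]_d -> R) :
  convex_function A f -> forall (x y : 'rV[R]_d) (t : R), 0 <= t -> t <= 1 -> A x -> A y ->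
  f (t *: x + (1 - t) *: y) <= t * f x + (1 - t) * f y.
Proof.
move=> cf x y t t0 t1 Ax Ay.
have t01 : Itv.spec (@Itv.num_sem R) (Itv.Real `[0%Z, 1%Z]) t.
  by rewrite /= /Itv.num_sem ger0_real//= in_itv/= t0.
by have := cf (Itv.mk t01) x y; rewrite !inE => /(_ Ax Ay).
Qed.

Lemma convex_slope (R : realType) (d : nat) (f : 'rV[R]_d -> R) (z w : 'rV[R]_d) (s t : R) :
  convex_function setT f -> 0 < s -> s <= t ->
  (f (z + s *: w) - f z) / s <= (f (z + t *: w) - f z) / t.
Proof.
move=> cf s0 st; have t0 : 0 < t by exact: lt_le_trans st.
have st1 : s / t <= 1 by rewrite ler_pdivrMr// mul1r.
have st0 : 0 <= s / t by rewrite divr_ge0// ltW.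
have := convex_functionP cf (x := z + t *: w) (y := z) st0 st1 Logic.I Logic.I.
have -> : (s / t) *: (z + t *: w) + (1 - s / t) *: z = z + s *: w.
  rewrite scalerDr addrAC -scalerDl [s / t + _]addrC subrK scale1r scalerA.
  by rewrite divfK ?gt_eqF.
move=> H; rewrite ler_pdivrMr// mulrAC.
have -> : (f (z + t *: w) - f z) * s / t = s / t * f (z + t *: w) - s / t * f z by ring.
lra.
Qed.

Lemma dotvv_ge0 (R : realType) (d : nat) (u : 'rV[R]_d) : 0 <= dotv u u.
Proof. by apply: sumr_ge0 => i _; rewrite -expr2 sqr_ge0. Qed.

Lemma dotvv_sub (R : realType) (d : nat) (p u : 'rV[R]_d) (s : R) :
  dotv (p - s *: u) (p - s *: u) = dotv p p - 2 * s * dotv p u + s ^+ 2 * dotv u u.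
Proof.
rewrite dotvBl dotvZl !(dotvC _ (p - _)) !dotvBl !dotvZl (dotvC u p); ring.
Qed.

(** Backward slopes of a concave function are nondecreasing in the step. The quadratic correction,
    evaluated at the convex combination of weight [s / t], adds [rho / 2 * dotv u u * (t - s)],
    which is relaxed to a multiple of [t]. *)
Lemma weakly_concave_slope (R : realType) (d : nat) (rho : R) (A : set 'rV[R]_d)
    (h : 'rV[R]_d -> R) (p u : 'rV[R]_d) (s t : R) :
  0 < rho -> weakly_concave rho A h -> 0 < s -> s <= t -> A p -> A (p - t *: u) ->
  (h p - h (p - s *: u)) / s <= (h p - h (p - t *: u)) / t + rho / 2 * dotv u u * t.
Proof.
move=> rho0 [_ cf] s0 st Ap Aq; have t0 : 0 < t by exact: lt_le_trans st.
have st1 : s / t <= 1 by rewrite ler_pdivrMr// mul1r.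
have st0 : 0 <= s / t by rewrite divr_ge0// ltW.
have := convex_functionP cf (x := p - t *: u) (y := p) st0 st1 Aq Ap.
have -> : (s / t) *: (p - t *: u) + (1 - s / t) *: p = p - s *: u.
  rewrite scalerBr addrAC -scalerDl [s / t + _]addrC subrK scale1r scalerA.
  by rewrite divfK ?gt_eqF.
rewrite /enorm !sqr_sqrtr ?dotvv_ge0// !dotvv_sub.
move: (dotv p p) (dotv p u) (dotvv_ge0 u); set N := dotv u u => P Q N0.
set hp := h p; set hs := h (p - s *: u); set ht := h (p - t *: u) => H.
have {}H : hp - hs <= s / t * (hp - ht) + rho / 2 * N * (s * t - s ^+ 2).
  have E : s / t * (- ht + rho / 2 * (P - 2 * t * Q + t ^+ 2 * N)) +
      (1 - s / t) * (- hp + rho / 2 * P) =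
      s / t * (hp - ht) - hp + rho / 2 * (P - 2 * s * Q + s * t * N).
    by field; rewrite gt_eqF.
  by move: H; rewrite E; lra.
rewrite ler_pdivrMr//; apply: (le_trans H).
have -> : ((hp - ht) / t + rho / 2 * N * t) * s = s / t * (hp - ht) + rho / 2 * N * (s * t) by ring.
rewrite lerD2l ler_wpM2l ?mulr_ge0 ?divr_ge0 ?(ltW rho0)//.
by rewrite gerDl oppr_le0 sqr_ge0.
Qed.

(** Meant for quotients of a fixed step: moving their end points by a multiple of [e] costs [K * e],
    where [K] may depend on the step but not on [e]. *)
Lemma le_of_linear_error (R : realType) (c B K e0 : R) : 0 < e0 ->
  (forall e, 0 < e -> e < e0 -> c - e <= B + K * e) -> c <= B.
Proof.
move=> e00 H; apply/ler_addgt0Pr => k k0.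
have K0 : 0 < `|K| + 1 by rewrite ltr_wpDl.
pose e := Num.min (e0 / 2) (k / (`|K| + 1)).
have e_gt0 : 0 < e by rewrite lt_min !divr_gt0.
have [h1 h2] : e <= e0 / 2 /\ e <= k / (`|K| + 1) by rewrite !ge_min !lexx orbT.
have := H e e_gt0; have -> : e < e0 by lra.
move=> /(_ isT) h3.
have : K * e <= `|K| * e by rewrite ler_wpM2r ?(ltW e_gt0)// ler_norm.
move: h2; rewrite ler_pdivlMr//; lra.
Qed.

Section cases.
Context (R : realType) (n m : nat).
Variables (Y : set 'rV[R]_m) (g : 'rV[R]_(n + m) -> R) (L : R) (xbar u : 'rV[R]_n)
  (ybar : 'rV[R]_m) (c : R).
Hypotheses (cY : compact Y) (Yn0 : Y !=set0) (L0 : 0 < L)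
  (gL : forall x y, `|g x - g y| <= L * `|x - y|)
  (ybarS : argmin_set Y g xbar ybar)
  (quot : forall d, 0 < d ->
    exists x y s, [/\ `|x - xbar| < d, `|y - ybar| < d, Y y, 0 < s < d &
      c - d <= (g (row_mx (x + s *: u) y) - g (row_mx x y)) / s]).

Let v := min_value Y g.

Let lip2 x x' y y' : `|g (row_mx x y) - g (row_mx x' y')| <= L * (`|x - x'| + `|y - y'|).
Proof.
rewrite -(subrKA (g (row_mx x' y))) mulrDr; apply: (le_trans (ler_normD _ _)).
by apply: lerD; [exact: lipschitz_xl|exact: lipschitz_xr].
Qed.

Lemma clarke_dd_min_value :
  (forall d, 0 < d -> exists t, 0 < t < d /\
    c - d <= (g (row_mx xbar ybar) - g (row_mx (xbar - t *: u) ybar)) / t) ->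
  (c%:E <= clarke_dd v xbar u)%E.
Proof.
move=> H; apply/clarke_ddP => e e0.
have u1 : 0 < `|u| + 1 by rewrite ltr_wpDl.
(* The second bound keeps the base point [xbar - t *: u] of the Clarke quotient within [e] of
   [xbar]. *)
pose d := Num.min e (e / (`|u| + 1)).
have d0 : 0 < d by rewrite lt_min e0 divr_gt0.
have [de de1] : d <= e /\ d <= e / (`|u| + 1) by rewrite !ge_min !lexx orbT.
have [t [/andP[t0 td] Ht]] := H d d0.
exists (xbar - t *: u), t; split => //; last 2 first.
- exact: lt_le_trans de.
- rewrite subrK (le_trans _ (le_trans Ht _))//; first by rewrite lerB.
  rewrite ler_pM2r ?invr_gt0// -/v lerB//.
    by rewrite /v (argmin_value cY Yn0 L0 gL ybarS).
  by apply: (min_value_le cY Yn0 L0 gL); case: ybarS.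
rewrite addrAC subrr add0r normrN normrZ gtr0_norm//.
apply: (@le_lt_trans _ _ (t * (`|u| + 1))); first by rewrite ler_pM2l// lerDl.
by rewrite -ltr_pdivlMr// (lt_le_trans td).
Qed.

(** The step [t] is fixed before the perturbation [e] tends to 0. The forward quotient at [x] is a
    backward quotient at [x + s *: u]; weak concavity lengthens its step from [s] to [t], after
    which the Lipschitz bound can move it to [(xbar, ybar)]. *)
Lemma clarke_weakly_concave (rho : R) (Omega : set 'rV[R]_n) :
  nbhs xbar Omega -> 0 < rho ->
  (forall y, Y y -> weakly_concave rho Omega (fun x => g (row_mx x y))) ->
  (c%:E <= clarke_dd v xbar u)%E.
Proof.
move=> /nbhs_ballP[r /= r0 rO] rho0 wc; apply: clarke_dd_min_value => d d0.
have u1 : 0 < `|u| + 1 by rewrite ltr_wpDl.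
have k1 : 0 < rho / 2 * dotv u u + 1 by rewrite ltr_wpDl// mulr_ge0 ?dotvv_ge0// divr_ge0// ltW.
(* The three bounds make the step smaller than [d], reserve half of the radius [r] for the
   displacement [t *: u], and keep the curvature error below [d]. *)
pose t := Num.min (d / 2) (Num.min (r / 2 / (`|u| + 1)) (d / (rho / 2 * dotv u u + 1))).
have t0 : 0 < t by rewrite !lt_min !divr_gt0.
have [t1 t2 t3] : [/\ t <= d / 2, t <= r / 2 / (`|u| + 1) & t <= d / (rho / 2 * dotv u u + 1)].
  by rewrite !ge_min !lexx !orbT.
have tu : t * `|u| <= r / 2.
  apply: (@le_trans _ _ (t * (`|u| + 1))); first by rewrite ler_pM2l// lerDl.
  by rewrite -ler_pdivlMr.
exists t; split; first by rewrite t0/=; lra.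
set B := (g _ - _) / t.
suff : c <= B + rho / 2 * dotv u u * t.
  have : rho / 2 * dotv u u * t <= d; last by lra.
  apply: (@le_trans _ _ ((rho / 2 * dotv u u + 1) * t)); first by rewrite ler_pM2r// lerDl.
  by rewrite mulrC -ler_pdivlMr.
pose e0 := Num.min t (r / 2 / (`|u| + 1)).
have e00 : 0 < e0 by rewrite lt_min t0 !divr_gt0.
(* Each of the two end points moves by at most [e * |u| + e] in [x] and [e] in [y]; dividing by the
   step [t] gives this constant. *)
apply: (@le_of_linear_error _ _ _ (2 * L * (`|u| + 2) / t) e0 e00) => e ep ee0.
have [et er] : e < t /\ e < r / 2 / (`|u| + 1).
  by split; apply: (lt_le_trans ee0); rewrite ge_min lexx ?orbT.
have [x [y [s [xx yy Yy /andP[s0 se] Hq]]]] := quot ep.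
have su : s * `|u| <= e * `|u| by rewrite ler_wpM2r// ltW.
have eu : e * `|u| + e < r / 2 by move: er; rewrite ltr_pdivlMr//; lra.
have px : `|x + s *: u - xbar| <= e * `|u| + e.
  rewrite addrAC addrC (le_trans (ler_normD _ _))// lerD ?(ltW xx)//.
  by rewrite normrZ gtr0_norm.
have Op : Omega (x + s *: u).
  by apply: rO; rewrite -ball_normE /= distrC; lra.
have Oq : Omega (x + s *: u - t *: u).
  apply: rO; rewrite -ball_normE /= distrC addrAC (le_lt_trans (ler_normB _ _))//.
  by rewrite normrZ gtr0_norm//; lra.
have := weakly_concave_slope rho0 (wc y Yy) s0 (ltW (lt_trans se et)) Op Oq.
rewrite addrK => /(le_trans Hq) H; apply: (le_trans H).
rewrite [leRHS]addrAC lerD2r /B.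
have -> : 2 * L * (`|u| + 2) / t * e = (2 * (L * (e * `|u| + e + e))) / t by ring.
rewrite -mulrDl ler_pM2r ?invr_gt0//.
have := lip2 (x + s *: u) xbar y ybar.
have := lip2 (x + s *: u - t *: u) (xbar - t *: u) y ybar.
rewrite (_ : x + s *: u - t *: u - (xbar - t *: u) = x + s *: u - xbar); last first.
  by rewrite opprB addrA subrK.
have : L * (`|x + s *: u - xbar| + `|y - ybar|) <= L * (e * `|u| + e + e).
  by rewrite ler_pM2l// lerD// ltW.
move=> h1 /le_trans/(_ h1) + /le_trans/(_ h1).
rewrite !ler_norml => /andP[+ _] /andP[_ +]; lra.
Qed.

(** By the mean value theorem and joint continuity of the partial gradient, all quotients near
    [(xbar, ybar)] tend to [D0]. The quotients in [quot] thus give [c <= D0], and the backward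
    quotients at [ybar] come back to [D0]. *)
Lemma clarke_C1 (Omega : set 'rV[R]_n) : nbhs xbar Omega ->
  (forall x y, Omega x -> Y y -> differentiable (fun x' => g (row_mx x' y)) x) ->
  {within rVprod Omega Y, continuous (fun z => gradx g (lsubmx z) (rsubmx z))} ->
  (c%:E <= clarke_dd v xbar u)%E.
Proof.
move=> nO dg cg; have [Yybar _] := ybarS.
pose D0 := dotv (gradx g xbar ybar) u.
have near_grad eta : 0 < eta -> exists2 d, 0 < d & forall x y, `|x - xbar| < d ->
    `|y - ybar| < d -> Y y -> Omega x /\ `|dotv (gradx g x y) u - D0| <= eta.
  move=> eta0; have nu0 : 0 < n%:R * `|u| + 1 by rewrite ltr_wpDl// mulr_ge0.
  have Az : rVprod Omega Y (row_mx xbar ybar).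
    by rewrite /rVprod/= row_mxKl row_mxKr; split => //; exact: nbhs_singleton.
  have gE : gradx g (lsubmx (row_mx xbar ybar)) (rsubmx (row_mx xbar ybar)) = gradx g xbar ybar.
    by rewrite row_mxKl row_mxKr.
  have cvz : (fun z => gradx g (lsubmx z) (rsubmx z)) @
      within (rVprod Omega Y) (nbhs (row_mx xbar ybar)) --> gradx g xbar ybar.
    by rewrite -gE; exact: (subspace_continuousP _ _).1 cg _ Az.
  have e0 : 0 < eta / (n%:R * `|u| + 1) by rewrite divr_gt0.
  have Nz : nbhs (row_mx xbar ybar) [set z | rVprod Omega Y z ->
      `|gradx g xbar ybar - gradx g (lsubmx z) (rsubmx z)| < eta / (n%:R * `|u| + 1)].
    exact: (@cvgr_dist_lt _ _ _ (within (rVprod Omega Y) (nbhs (row_mx xbar ybar))) _ _ _ cvz).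
  have [[A B] /= [/nbhs_ballP[a /= a0 aA] /nbhs_ballP[b /= b0 bB]] AB] := near_row_mx Nz.
  have /nbhs_ballP[r /= r0 rO] := nO.
  exists (Num.min a (Num.min b r)); first by rewrite !lt_min a0 b0.
  move=> x y; rewrite !lt_min => /and3P[xa xb xr] /and3P[ya yb yr] Yy.
  have Ox : Omega x by apply: rO; rewrite -ball_normE /= distrC.
  split => //.
  have := AB (x, y); rewrite /= row_mxKl row_mxKr => H.
  have {}H : `|gradx g xbar ybar - gradx g x y| < eta / (n%:R * `|u| + 1).
    apply: H; last by rewrite /rVprod/= row_mxKl row_mxKr.
    by split; [apply: aA|apply: bB]; rewrite -ball_normE /= distrC.
  rewrite /D0 -dotvBl.
  apply: (le_trans (normr_dotv_le _ (row_coord_le_norm _))).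
  apply: (@le_trans _ _ ((n%:R * `|u| + 1) * (eta / (n%:R * `|u| + 1)))); last first.
    by rewrite mulrCA mulfV ?mulr1// gt_eqF.
  rewrite mulrAC; apply: (@le_trans _ _ ((n%:R * `|u| + 1) * `|gradx g x y - gradx g xbar ybar|)).
    by rewrite ler_wpM2r// lerDl.
  rewrite (ler_pM2l nu0) -normrN opprB; exact: ltW H.
have quot_near eta : 0 < eta -> exists2 d, 0 < d & forall x y s, `|x - xbar| < d ->
    `|y - ybar| < d -> Y y -> 0 < s -> s < d ->
    `|(g (row_mx (x + s *: u) y) - g (row_mx x y)) / s - D0| <= eta.
  move=> eta0; have [d d0 Hd] := near_grad eta eta0.
  have u1 : 0 < `|u| + 1 by rewrite ltr_wpDl.
  exists (Num.min (d / 2) (d / 2 / (`|u| + 1))); first by rewrite lt_min !divr_gt0.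
  move=> x y s; rewrite !lt_min => /andP[x1 _] /andP[y1 _] Yy s0 /andP[_ s2].
  have su : s * `|u| < d / 2.
    apply: (@le_lt_trans _ _ (s * (`|u| + 1))); first by rewrite ler_pM2l// lerDl.
    by rewrite -ltr_pdivlMr.
  have seg (t : R) : 0 <= t <= 1 -> `|x + t *: (s *: u) - xbar| < d.
    move=> /andP[t0 t1]; rewrite addrAC (le_lt_trans (ler_normD _ _))//.
    rewrite !normrZ (ger0_norm t0) (gtr0_norm s0).
    have : t * (s * `|u|) <= s * `|u| by rewrite ler_piMl// mulr_ge0// ltW.
    lra.
  have yd : `|y - ybar| < d by lra.
  have [t t01|t t01 E] := @MVT_row R n (fun x' => g (row_mx x' y)) x (s *: u).
    by apply: dg => //; exact: (Hd _ y (seg t t01) yd Yy).1.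
  have [_ H] := Hd _ y (seg t t01) yd Yy.
  by rewrite E dotvC dotvZl dotvC mulrC mulKf ?gt_eqF.
have cD0 : c <= D0.
  apply/ler_addgt0Pr => e e0; have e2 : 0 < e / 2 by rewrite divr_gt0.
  have [d d0 Hd] := quot_near _ e2.
  pose d' := Num.min d (e / 2).
  have d'0 : 0 < d' by rewrite lt_min d0.
  have [x [y [s [xx yy Yy /andP[s0 sd] Hq]]]] := quot d'0.
  have [h1 h2] : d' <= d /\ d' <= e / 2 by rewrite !ge_min !lexx orbT.
  have := Hd x y s (lt_le_trans xx h1) (lt_le_trans yy h1) Yy s0 (lt_le_trans sd h1).
  by rewrite ler_norml => /andP[_]; lra.
apply: clarke_dd_min_value => e e0.
have [d d0 Hd] := quot_near _ e0.
have u1 : 0 < `|u| + 1 by rewrite ltr_wpDl.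
pose t := Num.min (Num.min (d / 2) (e / 2)) (d / 2 / (`|u| + 1)).
have t0 : 0 < t by rewrite !lt_min !divr_gt0.
have [t1 t2 t3] : [/\ t <= d / 2, t <= e / 2 & t <= d / 2 / (`|u| + 1)].
  by rewrite !ge_min !lexx !orbT.
exists t; split; first by rewrite t0/=; lra.
have tu : t * `|u| <= d / 2.
  apply: (@le_trans _ _ (t * (`|u| + 1))); first by rewrite ler_pM2l// lerDl.
  by rewrite -ler_pdivlMr.
(* The backward quotient at [xbar] is the forward quotient with base point [xbar - t *: u]. *)
have := Hd (xbar - t *: u) ybar t; rewrite subrK subrr normr0 addrAC subrr add0r normrN.
rewrite normrZ gtr0_norm//.
have -> : t * `|u| < d by lra.
have -> : t < d by lra.
move=> /(_ isT d0 Yybar t0 isT); rewrite ler_norml => /andP[+ _]; lra.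
Qed.

Lemma clarke_convex : convex_set Y -> convex_function setT g ->
  clarke g (row_mx xbar ybar) = rVprod (clarkex g xbar ybar) (clarkey g xbar ybar) ->
  (c%:E <= clarke_dd v xbar u)%E.
Proof.
move=> cvY cg prodE; have [Yybar _] := ybarS.
have row_seg x y s : row_mx (x + s *: u) y = row_mx x y + s *: row_mx u 0.
  by rewrite scale_row_mx scaler0 add_row_mx addr0.
(* Slopes of a convex function increase with the step, so the quotient of step [s] at [(x, y)] is
   lengthened to the fixed step [t] before being moved to [(xbar, ybar)]. *)
have dir_le t : 0 < t -> c <= (g (row_mx (xbar + t *: u) ybar) - g (row_mx xbar ybar)) / t.
  move=> t0; apply: (@le_of_linear_error _ _ _ (4 * L / t) t t0) => e e0 et.
  have [x [y [s [xx yy Yy /andP[s0 se] Hq]]]] := quot e0.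
  apply: (le_trans Hq); rewrite row_seg.
  apply: (le_trans (convex_slope (row_mx x y) (row_mx u 0) cg s0 (ltW (lt_trans se et)))).
  rewrite -row_seg.
  have -> : 4 * L / t * e = (2 * (L * (e + e))) / t by ring.
  rewrite -mulrDl ler_pM2r ?invr_gt0//.
  have := lip2 (x + t *: u) (xbar + t *: u) y ybar.
  have := lip2 x xbar y ybar.
  rewrite (_ : x + t *: u - (xbar + t *: u) = x - xbar); last first.
    by rewrite opprD addrACA subrr addr0.
  have h1 : L * (`|x - xbar| + `|y - ybar|) <= L * (e + e).
    by rewrite ler_pM2l// lerD// ltW.
  move=> /le_trans/(_ h1) + /le_trans/(_ h1).
  rewrite !ler_norml => /andP[+ _] /andP[_ +]; lra.
have u1 : 0 < `|u| + 1 by rewrite ltr_wpDl.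
have c_x : (c%:E <= clarke_dd (fun x => g (row_mx x ybar)) xbar u)%E.
  apply/clarke_ddP => e e0; exists xbar, (e / 2); rewrite subrr normr0; split => //.
  - by rewrite divr_gt0.
  - lra.
  - by apply: le_trans (dir_le _ _); rewrite ?divr_gt0//; lra.
have gx a b : `|g (row_mx a ybar) - g (row_mx b ybar)| <= L * `|a - b| by exact: lipschitz_xl.
have gy a b : `|g (row_mx xbar a) - g (row_mx xbar b)| <= L * `|a - b| by exact: lipschitz_xr.
have [eta Heta etaE] := clarke_support gx xbar u.
have c_eta : c <= dotv eta u by rewrite -lee_fin etaE.
have dir_v t : 0 < t -> c * t <= v (xbar + t *: u) - v xbar.
  move=> t0; have [y [Yy _] vE] := min_value_attained cY Yn0 L0 gL (xbar + t *: u).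
  rewrite /v vE (argmin_value cY Yn0 L0 gL ybarS).
  (* [zeta] is chosen to attain the derivative towards [y]. This is nonnegative because the segment
     from [ybar] to [y] stays in [Y], where [ybar] minimizes. *)
  have [zeta Hzeta zetaE] := clarke_support gy ybar (y - ybar).
  have zeta0 : 0 <= dotv zeta (y - ybar).
    rewrite -lee_fin zetaE; apply/clarke_ddP => e e0.
    pose s := Num.min 1 (e / 2).
    have s0 : 0 < s by rewrite lt_min ltr01 divr_gt0.
    have [s1 s2] : s <= 1 /\ s <= e / 2 by rewrite !ge_min !lexx orbT.
    exists ybar, s; rewrite subrr normr0; split => //; first lra.
    rewrite sub0r; apply: (@le_trans _ _ 0); first by rewrite oppr_le0 ltW.
    rewrite divr_ge0 ?(ltW s0)// subr_ge0.
    have [_ Hmin] := ybarS; apply: Hmin.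
    have := convex_setP cvY (ltW s0) s1 Yy Yybar.
    by rewrite scalerBl scale1r scalerBr addrA [ybar + _]addrC addrAC.
  have : clarke g (row_mx xbar ybar) (row_mx eta zeta).
    by rewrite prodE /rVprod/= row_mxKl row_mxKr.
  move=> /(_ (row_mx (t *: u) (y - ybar))) Hg.
  have dE : dotv (row_mx eta zeta) (row_mx (t *: u) (y - ybar)) =
      t * dotv eta u + dotv zeta (y - ybar).
    rewrite /dotv big_split_ord /=; congr (_ + _).
      by rewrite mulr_sumr; apply: eq_bigr => i _; rewrite !row_mxEl mxE mulrCA.
    by apply: eq_bigr => i _; rewrite !row_mxEr.
  apply: (@le_trans _ _ (dotv (row_mx eta zeta) (row_mx (t *: u) (y - ybar)))).
    rewrite dE mulrC; have : t * c <= t * dotv eta u by rewrite ler_pM2l.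
    lra.
  (* Lengthening the step to 1 turns the Clarke inequality into the subgradient inequality of convex
     analysis; the two end points move by less than [e], hence [2 * L]. *)
  apply: (@le_of_linear_error _ _ _ (2 * L) 1 ltr01) => e e0 e1.
  have [w [s [wz s0 se Hq]]] := (clarke_ddP _ _ _ _).1 Hg e e0.
  apply: (le_trans Hq).
  apply: (le_trans (convex_slope w _ cg s0 (ltW (lt_trans se e1)))).
  rewrite scale1r divr1.
  have := gL w (row_mx xbar ybar).
  have := gL (w + row_mx (t *: u) (y - ybar)) (row_mx (xbar + t *: u) y).
  rewrite (_ : w + _ - _ = w - row_mx xbar ybar); last first.
    rewrite (_ : row_mx (xbar + t *: u) y = row_mx xbar ybar + row_mx (t *: u) (y - ybar)).
      by rewrite opprD addrACA subrr addr0.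
    by rewrite add_row_mx [ybar + _]addrC subrK.
  have h1 : L * `|w - row_mx xbar ybar| <= L * e by rewrite ler_pM2l// ltW.
  move=> /le_trans/(_ h1) + /le_trans/(_ h1).
  rewrite !ler_norml => /andP[_ +] /andP[+ _]; lra.
apply/clarke_ddP => e e0; exists xbar, (e / 2); rewrite subrr normr0.
have e20 : 0 < e / 2 by rewrite divr_gt0.
split => //; first lra.
apply: (@le_trans _ _ c); first lra.
by rewrite ler_pdivlMr// dir_v.
Qed.

End cases.

(** * Existence of limit gradients and conclusion *)

Lemma nonempty_grad_limsup (R : realType) (n : nat) (f_ : R -> 'rV[R]_n -> R) (z : 'rV[R]_n) (C : R) :
  (\forall mu \near (0 : R)^'+, forall i, `|grad (f_ mu) z 0 i| <= C) ->
  grad_limsup f_ z !=set0.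
Proof.
move=> HC.
have /nbhs_ballP[d /= d0 Hd] : nbhs (0 : R)
    [set mu | 0 < mu -> forall i, `|grad (f_ mu) z 0 i| <= C].
  exact: HC.
(* With [k.+2], already the parameter of index 0 is strictly below [d], where the gradient bound
   holds. *)
pose mu k : R := d / k.+2%:R.
have mu0 k : 0 < mu k by rewrite divr_gt0.
have mud k : mu k < d by rewrite ltr_pdivrMr// ltr_pMr// ltr1n.
pose G k := grad (f_ (mu k)) z.
have GC k i : `|G k 0 i| <= C.
  by apply: (Hd (mu k)) => //; rewrite -ball_normE /= sub0r normrN gtr0_norm.
pose K := [set w : 'rV[R]_n | forall i, w ord0 i \in `[- C, C]].
have cK : compact K.
  apply: (@rV_compact _ _ (fun=> `[- C, C]%classic)) => _; exact: segment_compact.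
have GK : (G @ \oo) K.
  by exists 0 => // k _ /= i; rewrite in_itv/= -ler_norml.
have [xi [_ clxi]] := cK _ _ GK.
(* A cluster point meets every tail of [G], so [k_ j] can be taken at least [j]; this makes
   [mu (k_ j)] tend to 0 although [k_] may fail to be monotone. *)
have /choice[k_ Hk] (j : nat) : exists k, (j <= k)%N /\ `|xi - G k| < j.+1%:R^-1.
  have j0 : 0 < j.+1%:R^-1 :> R by rewrite invr_gt0.
  have [|_ [[k jk <-] Hb]] := clxi [set G k | k in [set k | (j <= k)%N]]
    (ball xi j.+1%:R^-1) _ (nbhsx_ballx xi _ j0).
    by exists j => // k jk; exists k.
  by exists k; split => //; move: Hb; rewrite -ball_normE.
exists xi, (fun=> z), (mu \o k_); split => [|j||].
- exact: cvg_cst.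
- exact: mu0.
- apply/cvgrPdist_lt => e e0; have ed0 : 0 < e / d by rewrite divr_gt0.
  have := @near_infty_natSinv_lt R (PosNum ed0).
  apply: filterS => j; rewrite /= ltr_pdivlMr// => H.
  rewrite sub0r normrN gtr0_norm// (le_lt_trans _ H)// /mu mulrC.
  rewrite ler_pM2r// lef_pV2 ?posrE// ler_nat.
  by apply: leq_trans (leqnSn _); rewrite ltnS; exact: (Hk j).1.
- apply/cvgrPdist_lt => e e0.
  have := @near_infty_natSinv_lt R (PosNum e0).
  apply: filterS => j; apply: lt_trans; exact: (Hk j).2.
Qed.

Theorem theorem4p12 (R : realType) (n m : nat)
    (X OX : set 'rV[R]_n) (Y OY : set 'rV[R]_m)
    (g : 'rV[R]_(n + m) -> R) (g_ : R -> 'rV[R]_(n + m) -> R)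
    (xbar : 'rV[R]_n) (Omega : set 'rV[R]_n) :
  X !=set0 -> closed X -> convex_set X ->
  compact Y -> convex_set Y -> (0 < lebesgue_rV Y)%E ->
  open OX -> X `<=` OX -> open OY -> Y `<=` OY ->
  lipschitz g ->
  smooth_approximations (rVprod OX OY) g g_ ->
  OX xbar ->
  (forall Omega' : set 'rV[R]_n, open Omega' -> closure Omega' `<=` OX ->
    {uniform rVprod (closure Omega') Y, g_ @ 0^'+ --> g}) ->
  {uniform Y,
    (fun (p : 'rV[R]_n * R) (y : 'rV[R]_m) =>
       dist_set (gradx (g_ p.2) p.1 y) (clarkex g p.1 y))
      @ filter_prod (nbhs xbar) 0^'+ --> (fun _ : 'rV[R]_m => 0 : R)} ->
  nbhs xbar Omega ->
  [\/ (forall x y, Omega x -> Y y ->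
         differentiable (fun x' => g (row_mx x' y)) x) /\
      {within rVprod Omega Y,
         continuous (fun z => gradx g (lsubmx z) (rsubmx z))},
      exists2 rho : R, 0 < rho &
        forall y, Y y -> weakly_concave rho Omega (fun x => g (row_mx x y))
    | (forall ybar, argmin_set Y g xbar ybar ->
         clarke g (row_mx xbar ybar) =
         rVprod (clarkex g xbar ybar) (clarkey g xbar ybar)) /\
      convex_function setT g] ->
  smooth_approximations OX (min_value Y g) (entropic Y g_) /\
  gradient_consistent (min_value Y g) (entropic Y g_) xbar.
Proof.
move=> _ _ _ cY cvY Y0 oOX _ oOY YOY glip [_ _ dg _] Oxbar gu gradu nO cases.
have [L L0 gL] := lipschitz_const glip.
have Yn0 := lebesgue_rV_gt0_nonempty Y0.
split; [split|split].
- exact: oOX.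
- by move=> z _; exact: (min_value_continuous cY Yn0 L0 gL).
- by move=> mu mu0; apply: (cont_differentiable_entropic oOX oOY YOY cY cvY Y0); exact: dg.
- by move=> z Oz; exact: (entropic_cvg oOX YOY cY cvY Y0 L0 gL dg gu Oz).
(* The sum dominates each of its nonnegative terms and thus bounds all coordinates at once. *)
- pose b := \sum_(i < n) (L + 1) * `|delta_mx 0 i : 'rV[R]_n|.
  apply: (@nonempty_grad_limsup _ _ _ _ b).
  have H (i : 'I_n) : \forall mu \near (0 : R)^'+, `|grad (entropic Y g_ mu) xbar 0 i| <= b.
    have [[A B] /= [nA nB] AB] := near_grad_entropic_bound oOX oOY YOY cY cvY Y0 L0 gL dg gu Oxbar
      gradu (delta_mx 0 i).
    apply: filterS nB => mu Bmu.
    have := AB (xbar, mu) (conj (nbhs_singleton nA) Bmu) => /=.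
    have -> : dotv (grad (entropic Y g_ mu) xbar) (delta_mx 0 i) = grad (entropic Y g_ mu) xbar 0 i.
      rewrite /dotv (bigD1 i)//= big1 ?addr0 => [|j ji].
        by rewrite [delta_mx _ _ _ _]mxE !eqxx mulr1.
      by rewrite [delta_mx _ _ _ _]mxE (negbTE ji) andbF mulr0.
    move=> /le_trans; apply; rewrite /b (bigD1 i)//= lerDl.
    by apply: sumr_ge0 => j _; rewrite mulr_ge0// ltW// addr_gt0.
  exact: (@filter_forall _ _ (fun i mu => `|grad (entropic Y g_ mu) xbar 0 i| <= b) _ _ H).
- move=> xi Hxi u.
  have [ybar ybarS quot] := limsup_argmin oOX oOY YOY cY cvY Y0 L0 gL dg gu Oxbar gradu u Hxi.
  have [[dgx cgx]|[rho rho0 wc]|[prodE cg]] := cases.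
  + exact: (clarke_C1 cY Yn0 L0 gL ybarS quot nO).
  + exact: (clarke_weakly_concave cY Yn0 L0 gL ybarS quot nO rho0).
  + exact: (clarke_convex cY Yn0 L0 gL ybarS quot cvY cg (prodE _ ybarS)).
Qed.
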